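(* Let $d,n\in\mathbb{N}$, $\alpha>1/2$, let $\boldsymbol{\gamma}=(\gamma_1,\gamma_2,\ldots)$ satisfy $1\ge\gamma_1\ge\gamma_2\ge\cdots>0$, and let $\boldsymbol{z}\in\{0,1,\ldots,n-1\}^d$. The root-mean-squared worst-case error of the tent-transformed randomly-shifted lattice rule in the cosine space $C_{d,\alpha,\boldsymbol{\gamma}}$ satisfies $$e^{\mathrm{wor}}_{\mathrm{rms}}(Q_n^{\mathrm{ran}}(\cdot\circ\psi;\boldsymbol{z});C_{d,\alpha,\boldsymbol{\gamma}})^2=\sum_{\boldsymbol{0}\ne\boldsymbol{k}\in\Lambda(\boldsymbol{z},n)^\perp}\frac{2^{-|\boldsymbol{k}|_0}}{r_{\alpha,\boldsymbol{\gamma}}(\boldsymbol{k})}=e^{\mathrm{wor}}(Q_n(\cdot;\boldsymbol{z});E_{d,\alpha,\boldsymbol{\gamma}/2})^2.$$ That is, its square is precisely the squared worst-case error of the lattice rule $Q_n(\cdot;\boldsymbol{z})$ in the Korobov space with the weights $\boldsymbol{\gamma}$ replaced by $\boldsymbol{\gamma}/2=(\gamma_1/2,\gamma_2/2,\ldots)$.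
   Context: Notation. $\mathbb{Z}_+=\{0,1,2,\ldots\}$. For $\boldsymbol{k}\in\mathbb{Z}^d$, $|\boldsymbol{k}|_0$ is the number of non-zero components. The half-period cosine basis of $L_2([0,1]^d)$ is $\phi_{\boldsymbol{k}}(\boldsymbol{x})=(\sqrt2)^{|\boldsymbol{k}|_0}\prod_{j=1}^d\cos(\pi k_jx_j)$, $\boldsymbol{k}\in\mathbb{Z}_+^d$, and $\hat f(\boldsymbol{k})=\int_{[0,1]^d}f\phi_{\boldsymbol{k}}$. Fourier coefficients are $\widetilde f(\boldsymbol{h})=\int_{[0,1]^d}f(\boldsymbol{x})e^{-2\pi\mathrm{i}\boldsymbol{h}\cdot\boldsymbol{x}}d\boldsymbol{x}$, $\boldsymbol{h}\in\mathbb{Z}^d$. For $\boldsymbol{k}\in\mathbb{Z}^d$, $r_{\alpha,\boldsymbol{\gamma}}(\boldsymbol{k})=\prod_{j=1}^d r_{\alpha,\gamma_j}(k_j)$, where $r_{\alpha,\gamma_j}(0)=1$ and $r_{\alpha,\gamma_j}(k)=|k|^{2\alpha}/\gamma_j$ for $k\ne0$. Cosine space: $C_{d,\alpha,\boldsymbol{\gamma}}=\{f\in L_2([0,1]^d):\|f\|^2=\sum_{\boldsymbol{k}\in\mathbb{Z}_+^d}|\hat f(\boldsymbol{k})|^2r_{\alpha,\boldsymbol{\gamma}}(\boldsymbol{k})<\infty\}$. Korobov space: $E_{d,\alpha,\boldsymbol{\gamma}}=\{f\in L_2([0,1]^d):\|f\|^2=\sum_{\boldsymbol{h}\in\mathbb{Z}^d}|\widetilde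 f(\boldsymbol{h})|^2r_{\alpha,\boldsymbol{\gamma}}(\boldsymbol{h})<\infty\}$. Functions are complex-valued; for $\alpha>1/2$ both are reproducing kernel Hilbert spaces, functions being identified with their continuous representatives given by their cosine, respectively Fourier, series. Dual lattice: $\Lambda(\boldsymbol{z},n)^\perp=\{\boldsymbol{h}\in\mathbb{Z}^d:\boldsymbol{h}\cdot\boldsymbol{z}\equiv0\pmod n\}$. Lattice rule: $Q_n(f;\boldsymbol{z})=\frac1n\sum_{i=1}^nf(\tfrac{i\boldsymbol{z}}n\bmod1)$. Tent transformation: $\psi(x)=1-|2x-1|$ on $[0,1]$, applied componentwise. Tent-transformed shifted lattice rule with shift $\boldsymbol{\Delta}\in[0,1]^d$: $Q_n(f\circ\psi;\boldsymbol{z},\boldsymbol{\Delta})=\frac1n\sum_{i=1}^nf\big(\psi((\tfrac{i\boldsymbol{z}}n+\boldsymbol{\Delta})\bmod1)\big)$. $Q_n^{\mathrm{ran}}(\cdot\circ\psi;\boldsymbol{z})$ denotes the randomized method with $\boldsymbol{\Delta}$ uniformly distributed on $[0,1]^d$. Worst-case integration error: $e^{\mathrm{wor}}(Q;H)=\sup_{f\in H,\|f\|_H\le1}|\int_{[0,1]^d}f(\boldsymbol{x})\,d\boldsymbol{x}-Q(f)|$. Root-mean-squared worst-case error: $e^{\mathrm{wor}}_{\mathrm{rms}}(Q_n^{\mathrm{ran}}(\cdot\circ\psi;\boldsymbol{z});C_{d,\alpha,\boldsymbol{\gamma}})=\Big(\int_{[0,1]^d}e^{\mathrm{wor}}(Q_n(\cdot\circ\psi;\boldsymbol{z},\boldsymbol{\Delta});C_{d,\alpha,\boldsymbol{\gamma}})^2\,d\boldsymbol{\Delta}\Big)^{1/2}$.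 *)

(* Defs.v *)
From HB Require Import structures.
From mathcomp Require Import all_boot all_order all_algebra.
From mathcomp Require Import finmap complex.
From mathcomp Require Import all_classical all_reals all_analysis.
From mathcomp.analysis.showcase Require summability.

Set Implicit Arguments.
Unset Strict Implicit.
Unset Printing Implicit Defensive.

Import Order.TTheory GRing.Theory Num.Theory.
Import numFieldNormedType.Exports.

Local Open Scope classical_set_scope.
Local Open Scope ring_scope.

Section lebesgue_tuples.
Context {R : realType}.
Local Notation TR := (measurableTypeR R).

Section step.
Variables (d : nat) (mu : {sigma_finite_measure set (d.-tuple TR) -> \bar R}).

Definition tuple_of_pair (p : TR * d.-tuple TR) : d.+1.-tuple TR :=
  [tuple of p.1 :: p.2].

Lemma measurable_tuple_of_pair : measurable_fun setT tuple_of_pair.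
Proof. exact: measurable_cons. Qed.

Definition lebesgue_measure_step : set (d.+1.-tuple TR) -> \bar R :=
  pushforward (lebesgue_measure \x mu)%E tuple_of_pair.

Let step0 : lebesgue_measure_step set0 = 0%E.
Proof. by rewrite /lebesgue_measure_step /pushforward preimage_set0 measure0. Qed.

Let step_ge0 A : (0 <= lebesgue_measure_step A)%E.
Proof. by rewrite /lebesgue_measure_step /pushforward measure_ge0. Qed.

Let step_sigma_additive : semi_sigma_additive lebesgue_measure_step.
Proof.
move=> F mF tF mUF; rewrite /lebesgue_measure_step /pushforward preimage_bigcup.
apply: measure_semi_sigma_additive.
- by move=> n; rewrite -[X in measurable X]setTI; exact: measurable_tuple_of_pair.
- apply/trivIsetP => /= i j _ _ ij; rewrite -preimage_setI.
  by move/trivIsetP : tF => /(_ _ _ _ _ ij) ->//; rewrite preimage_set0.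
- rewrite -preimage_bigcup -[X in measurable X]setTI.
  exact: measurable_tuple_of_pair.
Qed.

HB.instance Definition _ := isMeasure.Build _ _ _ lebesgue_measure_step
  step0 step_ge0 step_sigma_additive.

Let pair_of_tuple (x : d.+1.-tuple TR) : TR * d.-tuple TR :=
  (thead x, [tuple of behead x]).

Let tuple_of_pairK : cancel tuple_of_pair pair_of_tuple.
Proof.
by move=> [x t]; rewrite /pair_of_tuple theadE; congr pair; exact/val_inj.
Qed.

Let pair_of_tupleK : cancel pair_of_tuple tuple_of_pair.
Proof. by move=> x; rewrite [RHS]tuple_eta. Qed.

Let measurable_pair_of_tuple : measurable_fun setT pair_of_tuple.
Proof.
apply: measurable_fun_pair; last exact: measurable_behead.
exact: measurable_tnth.
Qed.

Let step_sigma_finite : sigma_finite setT lebesgue_measure_step.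
Proof.
pose l : {sigma_finite_measure set TR -> \bar R} := lebesgue_measure.
have /sigma_finiteP[F [TF ndF Foo]] := sigma_finiteT l.
have /sigma_finiteP[G [TG ndG Goo]] := sigma_finiteT mu.
exists (fun n => pair_of_tuple @^-1` (F n `*` G n)).
  rewrite -preimage_bigcup (_ : \bigcup_n _ = setT) ?preimage_setT//.
  rewrite -setXTT TF TG predeqE => -[x y]; split.
    by move=> [n _ []/= ? ?]; split; exists n.
  move=> [/= [n _ Fnx] [k _ Gky]]; exists (maxn n k) => //; split.
    by move: x Fnx; exact/subsetPset/ndF/leq_maxl.
  by move: y Gky; exact/subsetPset/ndG/leq_maxr.
move=> n; have [mF Fn] := Foo n; have [mG Gn] := Goo n; split.
  rewrite -[X in measurable X]setTI; apply: measurable_pair_of_tuple => //.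
  exact: measurableX.
rewrite /lebesgue_measure_step /pushforward -comp_preimage.
rewrite (_ : _ \o _ = id); last by apply/funext => p /=; rewrite tuple_of_pairK.
by rewrite preimage_id product_measure1E// lte_mul_pinfty// ge0_fin_numE.
Qed.

HB.instance Definition _ := Measure_isSigmaFinite.Build _ _ _
  lebesgue_measure_step step_sigma_finite.

End step.

Fixpoint lebesgue_measure_tuple (d : nat) :
    {sigma_finite_measure set (d.-tuple TR) -> \bar R} :=
  if d is d'.+1 then lebesgue_measure_step (lebesgue_measure_tuple d')
  else \d_([tuple] : 0.-tuple TR).

Lemma lebesgue_measure_tuple_box (d : nat) (A : 'I_d -> set TR) :
  (forall j, measurable (A j)) ->
  lebesgue_measure_tuple d [set x | forall j, A j (tnth x j)] =
  (\prod_(j < d) lebesgue_measure (A j))%E.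
Proof.
elim: d A => [|d IH] A mA.
  by rewrite big_ord0 /= diracE mem_set// => -[].
rewrite big_ord_recl -IH; last by move=> j; exact: mA.
rewrite -product_measure1E//=; last first.
  rewrite (_ : [set _ | _] = \big[setI/setT]_(j < d)
      ((fun x : d.-tuple TR => tnth x j) @^-1` A (lift ord0 j))).
    apply: bigsetI_measurable => j _.
    by rewrite -[X in measurable X]setTI; exact: measurable_tnth.
  apply/seteqP; split=> x /=; rewrite -bigcap_seq.
    by move=> Ax j _; exact: Ax.
  by move=> Ax j; apply: (Ax j); rewrite /= mem_index_enum.
rewrite /lebesgue_measure_step /pushforward; congr product_measure1.
apply/seteqP; split=> -[x t] /=.
  move=> Axt; split=> [|j]; first exact: (Axt ord0).
  by have := Axt (lift ord0 j); rewrite tnthS.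
move=> [Ax At] j; case: (unliftP ord0 j) => [i|] ->; last exact: Ax.
by rewrite tnthS; exact: At.
Qed.

End lebesgue_tuples.

Arguments lebesgue_measure_tuple {R} d.

Section spaces.
Context {R : realType}.
Implicit Types (d : nat) (alpha : R) (gamma : nat -> R).
Local Open Scope complex_scope.

Definition unit_cube d : set (d.-tuple R) :=
  [set x | forall j, 0 <= tnth x j <= 1].
Arguments unit_cube : clear implicits.

Definition cintegral d (f : d.-tuple R -> R[i]) : R[i] :=
  (\int[lebesgue_measure_tuple d]_(x in unit_cube d) complex.Re (f x)) +i*
  (\int[lebesgue_measure_tuple d]_(x in unit_cube d) complex.Im (f x)).

Definition cmodulus (w : R[i]) : R := ComplexField.Normc.normc w.

Definition square_integrable d (f : d.-tuple R -> R[i]) : Prop :=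
  [/\ measurable_fun (unit_cube d) (fun x => complex.Re (f x)),
      measurable_fun (unit_cube d) (fun x => complex.Im (f x)) &
      (\int[lebesgue_measure_tuple d]_(x in unit_cube d)
         ((cmodulus (f x)) ^+ 2)%:E < +oo)%E].

(** Unconditional summability: convergence of the net of finite partial sums. *)
Definition sums_to (I : choiceType) (u : I -> R[i]) (s : R[i]) : Prop :=
  (fun A : {fset I} => \sum_(i <- A) u i : R[i]^o) @ summability.totally
    --> (s : R[i]^o).

(** The index [j : 'I_d] is 0-based: [gamma j] is the weight of the
    coordinate number [j + 1]. *)
Definition weight1 alpha (g : R) (k : int) : R :=
  if k == 0 then 1 else (`|k|%N%:R `^ (2 * alpha)) / g.

Definition weight d alpha gamma (k : d.-tuple int) : R :=
  \prod_(j < d) weight1 alpha (gamma j) (tnth k j).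

Definition nnz d (k : d.-tuple int) : nat := count (fun c => c != 0) k.

Definition tuple_int d (k : d.-tuple nat) : d.-tuple int := map_tuple Posz k.

Definition cosine_basis d (k : d.-tuple nat) (x : d.-tuple R) : R :=
  Num.sqrt 2 ^+ nnz (tuple_int k) *
  \prod_(j < d) cos (pi * (tnth k j)%:R * tnth x j).

Definition cosine_coef d (f : d.-tuple R -> R[i]) (k : d.-tuple nat) : R[i] :=
  cintegral (fun x => f x * (cosine_basis k x)%:C).

Definition cosine_norm d alpha gamma (f : d.-tuple R -> R[i]) : \bar R :=
  sqrte (\esum_(k in [set: d.-tuple nat])
    ((cmodulus (cosine_coef f k)) ^+ 2 * weight alpha gamma (tuple_int k))%:E).

(** Elements are functions, not classes: the last condition selects, in the
    class of [f], the representative given by the (absolutely convergent)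
    cosine series. The values of [f] off the cube are irrelevant. *)
Definition cosine_space d alpha gamma : set (d.-tuple R -> R[i]) :=
  [set f | [/\ square_integrable f,
               (cosine_norm alpha gamma f < +oo)%E &
               forall x, unit_cube d x ->
                 sums_to (fun k => cosine_coef f k * (cosine_basis k x)%:C)
                         (f x)]].

(** [expi t] is the exponential of the imaginary number [t * i]. *)
Definition expi (t : R) : R[i] := cos t +i* sin t.

Definition dot d (h : d.-tuple int) (x : d.-tuple R) : R :=
  \sum_(j < d) (tnth h j)%:~R * tnth x j.

Definition fourier_coef d (f : d.-tuple R -> R[i]) (h : d.-tuple int) : R[i] :=
  cintegral (fun x => f x * expi (- (2 * pi * dot h x))).

Definition korobov_norm d alpha gamma (f : d.-tuple R -> R[i]) : \bar R :=
  sqrte (\esum_(h in [set: d.-tuple int])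
    ((cmodulus (fourier_coef f h)) ^+ 2 * weight alpha gamma h)%:E).

(** Same choice of representatives as in [cosine_space], with Fourier series. *)
Definition korobov_space d alpha gamma : set (d.-tuple R -> R[i]) :=
  [set f | [/\ square_integrable f,
               (korobov_norm alpha gamma f < +oo)%E &
               forall x, unit_cube d x ->
                 sums_to (fun h => fourier_coef f h * expi (2 * pi * dot h x))
                         (f x)]].

Definition frac (t : R) : R := t - (Num.floor t)%:~R.

Definition lattice_rule d n (z : d.-tuple 'I_n) (f : d.-tuple R -> R[i]) :
    R[i] :=
  n%:R^-1 * \sum_(1 <= i < n.+1)
    f [tuple frac (i%:R * (tnth z j)%:R / n%:R) | j < d].

Definition shifted_lattice_rule d n (z : d.-tuple 'I_n) (Delta : d.-tuple R)
    (f : d.-tuple R -> R[i]) : R[i] :=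
  n%:R^-1 * \sum_(1 <= i < n.+1)
    f [tuple frac (i%:R * (tnth z j)%:R / n%:R + tnth Delta j) | j < d].

Definition tent1 (t : R) : R := 1 - `|2 * t - 1|.

Definition tent d (x : d.-tuple R) : d.-tuple R := map_tuple tent1 x.

Definition tent_shifted_lattice_rule d n (z : d.-tuple 'I_n)
    (Delta : d.-tuple R) (f : d.-tuple R -> R[i]) : R[i] :=
  shifted_lattice_rule z Delta (f \o @tent d).

Definition dual_lattice d n (z : d.-tuple 'I_n) : set (d.-tuple int) :=
  [set h | (n%:Z %| \sum_(j < d) tnth h j * (tnth z j)%:Z)%Z].

(** The supremum is taken in [\bar R], hence always defined. *)
Definition worst_case_error d (H : set (d.-tuple R -> R[i]))
    (norm : (d.-tuple R -> R[i]) -> \bar R)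
    (Q : (d.-tuple R -> R[i]) -> R[i]) : \bar R :=
  ereal_sup [set (cmodulus (cintegral f - Q f))%:E |
             f in [set f | H f /\ (norm f <= 1)%E]].

Definition cosine_wce d alpha gamma (Q : (d.-tuple R -> R[i]) -> R[i]) :=
  worst_case_error (cosine_space alpha gamma) (cosine_norm alpha gamma) Q.

Definition korobov_wce d alpha gamma (Q : (d.-tuple R -> R[i]) -> R[i]) :=
  worst_case_error (@korobov_space d alpha gamma) (korobov_norm alpha gamma) Q.

(** The cube has measure 1 ([lebesgue_measure_tuple_box]), so that this integral
    is the expectation over a uniformly distributed shift. *)
Definition rms_cosine_wce d n alpha gamma (z : d.-tuple 'I_n) : \bar R :=
  sqrte (\int[lebesgue_measure_tuple d]_(Delta in unit_cube d)
    (cosine_wce alpha gamma (tent_shifted_lattice_rule z Delta)) ^+ 2)%E.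

End spaces.

(* Main.v *)
Require Import Defs.
From mathcomp Require Import all_boot all_order all_algebra.
From mathcomp Require Import finmap complex.
From mathcomp Require Import all_classical all_reals all_analysis.
From mathcomp Require Import measurable_realfun ring lra.

Set Implicit Arguments.
Unset Strict Implicit.
Unset Printing Implicit Defensive.

Import Order.TTheory GRing.Theory Num.Theory.
Import numFieldNormedType.Exports.

Local Open Scope classical_set_scope.
Local Open Scope ring_scope.

(* In both spaces a function is the sum of an orthonormal series, the norm being
   a weighted l^2 norm of the coefficients, so by Cauchy-Schwarz the squared
   worst-case error of a quadrature rule Q of total mass 1 is the sum of
   |Q(phi_k)|^2 / r(k) over the nonzero indices k. For the lattice rule and the
   Fourier basis, Q(phi_h) is the indicator of the dual lattice, and halving the
   weights multiplies r(h) by 2^|h|_0. For the cosine basis,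
   cos (pi k psi(x)) = cos (2 pi k x) for integer k, and averaging |Q(phi_k)|^2
   over the shift gives
     n^-2 sum_(i,l) prod_j cos (2 pi k_j (i - l) z_j / n);
   expanding the product over the sign patterns of k turns this into 2^-|k|_0
   times the number of h in the dual lattice with (|h_1|,...,|h_d|) = k. *)

(** * Bounded measurable functions *)

(** Every integral that is actually computed is that of a finite sum of products of bounded
    one-variable functions. Such functions form an algebra, and on a set of finite measure all of
    them are integrable; this class discharges the side conditions of linearity and Fubini. The
    random shift is what removes the cross terms: in cos u cos v = (cos (u - v) + cos (u + v)) / 2
    the shift cancels from u - v and oscillates in u + v. The factor 2^-|k|_0 then comes from cos t
    = (e^(it) + e^(-it)) / 2, once for each nonzero coordinate. All sums have nonnegative terms and
    live in [\bar R], so exchanging the sum over k with the average over the shift is Tonelli.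
    Finiteness is a separate matter: coordinate by coordinate, it is the convergence of a p-series
    with exponent 2 alpha > 1. *)

Definition bounded_measurable {d} {T : measurableType d} {R : realType}
    (f : T -> R) : Prop :=
  measurable_fun setT f /\ exists M, forall x, `|f x| <= M.

Section bounded_measurable.
Context {d} {T : measurableType d} {R : realType}.
Implicit Types f g : T -> R.

Lemma bounded_measurable_cst (r : R) : bounded_measurable (fun _ : T => r).
Proof. by split; [exact: measurable_cst|exists `|r|]. Qed.

Lemma bounded_measurableD f g : bounded_measurable f -> bounded_measurable g ->
  bounded_measurable (fun x => f x + g x).
Proof.
move=> [mf [M fM]] [mg [N gN]]; split; first exact: measurable_funD.
by exists (M + N) => x; apply: le_trans (ler_normD _ _) _; exact: lerD.
Qed.

Lemma bounded_measurableM f g : bounded_measurable f -> bounded_measurable g ->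
  bounded_measurable (fun x => f x * g x).
Proof.
move=> [mf [M fM]] [mg [N gN]]; split; first exact: measurable_funM.
by exists (M * N) => x; rewrite normrM; apply: ler_pM.
Qed.

Lemma bounded_measurableN f : bounded_measurable f ->
  bounded_measurable (fun x => - f x).
Proof.
move=> [mf [M fM]]; split; first exact: measurableT_comp.
by exists M => x; rewrite normrN.
Qed.

Lemma bounded_measurableB f g : bounded_measurable f -> bounded_measurable g ->
  bounded_measurable (fun x => f x - g x).
Proof. by move=> bf /bounded_measurableN; exact: bounded_measurableD. Qed.

Lemma bounded_measurable_integrable (mu : {measure set T -> \bar R}) D f :
  measurable D -> (mu D < +oo)%E -> bounded_measurable f ->
  mu.-integrable D (EFin \o f).
Proof.
move=> mD Doo [mf [M fM]]; apply: measurable_bounded_integrable => //.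
  exact: measurable_funTS.
by exists M; split; [exact: num_real|move=> y My x _; exact: le_trans (ltW My)].
Qed.

End bounded_measurable.

Section complex_bounded_measurable.
Context {d} {T : measurableType d} {R : realType}.
Local Open Scope complex_scope.
Implicit Types f g : T -> R[i].

Definition complex_bounded_measurable f : Prop :=
  bounded_measurable (fun x => complex.Re (f x)) /\
  bounded_measurable (fun x => complex.Im (f x)).

Lemma ReM (a b : R[i]) : complex.Re (a * b) =
  complex.Re a * complex.Re b - complex.Im a * complex.Im b.
Proof. by case: a; case: b. Qed.

Lemma ImM (a b : R[i]) : complex.Im (a * b) =
  complex.Re a * complex.Im b + complex.Im a * complex.Re b.
Proof. by case: a; case: b. Qed.

Lemma complex_bounded_measurable_cst (c : R[i]) :
  complex_bounded_measurable (fun _ => c).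
Proof. by split; exact: bounded_measurable_cst. Qed.

Lemma complex_bounded_measurableD f g :
  complex_bounded_measurable f -> complex_bounded_measurable g ->
  complex_bounded_measurable (fun x => f x + g x).
Proof.
move=> [rf jf] [rg jg]; split.
  have -> : (fun x => complex.Re (f x + g x)) =
            (fun x => complex.Re (f x) + complex.Re (g x)).
    by apply/funext => x; exact: raddfD.
  exact: bounded_measurableD.
have -> : (fun x => complex.Im (f x + g x)) =
          (fun x => complex.Im (f x) + complex.Im (g x)).
  by apply/funext => x; exact: raddfD.
exact: bounded_measurableD.
Qed.

Lemma complex_bounded_measurableM f g :
  complex_bounded_measurable f -> complex_bounded_measurable g ->
  complex_bounded_measurable (fun x => f x * g x).
Proof.
move=> [rf jf] [rg jg]; split.
  under eq_fun do rewrite ReM.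
  by apply: bounded_measurableB; exact: bounded_measurableM.
under eq_fun do rewrite ImM.
by apply: bounded_measurableD; exact: bounded_measurableM.
Qed.

Lemma complex_bounded_measurable_sum I (s : seq I) (F : I -> T -> R[i]) :
  (forall i, complex_bounded_measurable (F i)) ->
  complex_bounded_measurable (fun x => \sum_(i <- s) F i x).
Proof.
move=> bF; elim: s => [|i s IH].
  by under eq_fun do rewrite big_nil; exact: complex_bounded_measurable_cst.
by under eq_fun do rewrite big_cons; exact: complex_bounded_measurableD.
Qed.

Lemma complex_bounded_measurable_prod I (s : seq I) (F : I -> T -> R[i]) :
  (forall i, complex_bounded_measurable (F i)) ->
  complex_bounded_measurable (fun x => \prod_(i <- s) F i x).
Proof.
move=> bF; elim: s => [|i s IH].
  by under eq_fun do rewrite big_nil; exact: complex_bounded_measurable_cst.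
by under eq_fun do rewrite big_cons; exact: complex_bounded_measurableM.
Qed.

Variables (mu : {measure set T -> \bar R}) (D : set T).
Hypotheses (mD : measurable D) (muD : (mu D < +oo)%E).

(** For the cube this is convertible to [cintegral]; linearity proved here for a general measure is
    applied to [cintegral] through that conversion. *)
Definition complex_integral f : R[i] :=
  (\int[mu]_(x in D) complex.Re (f x)) +i* (\int[mu]_(x in D) complex.Im (f x)).

Lemma complex_integralD f g :
  complex_bounded_measurable f -> complex_bounded_measurable g ->
  complex_integral (fun x => f x + g x) =
  complex_integral f + complex_integral g.
Proof.
move=> [rf jf] [rg jg]; rewrite /complex_integral; simpc; congr (_ +i* _).
  rewrite -RintegralD//; do ?exact: bounded_measurable_integrable.
  by apply: eq_Rintegral => x _; exact: raddfD.
rewrite -RintegralD//; do ?exact: bounded_measurable_integrable.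
by apply: eq_Rintegral => x _; exact: raddfD.
Qed.

Lemma complex_integralZ c f : complex_bounded_measurable f ->
  complex_integral (fun x => c * f x) = c * complex_integral f.
Proof.
move=> [rf jf]; have zi (r : R) (g : T -> R) : bounded_measurable g ->
    mu.-integrable D (EFin \o (fun x => r * g x)).
  move=> bg; apply: bounded_measurable_integrable => //.
  by apply: bounded_measurableM => //; exact: bounded_measurable_cst.
have bi (g : T -> R) : bounded_measurable g -> mu.-integrable D (EFin \o g).
  exact: bounded_measurable_integrable.
case: c => a b; rewrite /complex_integral; simpc; congr (_ +i* _).
  under eq_Rintegral do rewrite ReM/=.
  by rewrite RintegralB ?RintegralZl//; [exact: bi|exact: bi|exact: zi|exact: zi].
under eq_Rintegral do rewrite ImM/=.
by rewrite RintegralD ?RintegralZl//; [exact: bi|exact: bi|exact: zi|exact: zi].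
Qed.

Lemma complex_integral_sum I (s : seq I) (F : I -> T -> R[i]) :
  (forall i, complex_bounded_measurable (F i)) ->
  complex_integral (fun x => \sum_(i <- s) F i x) =
  \sum_(i <- s) complex_integral (F i).
Proof.
move=> bF; elim: s => [|i s IH].
  rewrite big_nil /complex_integral.
  by under eq_Rintegral do rewrite big_nil/=;
     under [X in _ +i* X]eq_Rintegral do rewrite big_nil/=;
     rewrite Rintegral_cst// mul0r.
rewrite big_cons -IH -complex_integralD//.
  by congr complex_integral; apply/funext => x; rewrite big_cons.
exact: complex_bounded_measurable_sum.
Qed.

End complex_bounded_measurable.

(** * Integration over the unit cube *)

Section unit_cube.
Context {R : realType}.
Local Notation TR := (measurableTypeR R).
Local Notation mu := lebesgue_measure_tuple.
Local Notation cube d := (@unit_cube R d).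

Lemma unit_cube_box d : (cube d) =
  [set x : d.-tuple TR | forall j, (fun _ => `[0, 1]%classic : set TR) j (tnth x j)].
Proof.
by apply/seteqP; split=> x /= xP j; have := xP j; rewrite /= in_itv/=.
Qed.

Lemma measurable_unit_cube d : measurable ((cube d) : set (d.-tuple TR)).
Proof.
rewrite (_ : (cube d) = \big[setI/setT]_(j < d)
    ((fun x : d.-tuple TR => tnth x j) @^-1` `[0, 1]%classic)).
  apply: bigsetI_measurable => j _.
  by rewrite -[X in measurable X]setTI; exact: measurable_tnth.
rewrite unit_cube_box; apply/seteqP; split=> x /=; rewrite -bigcap_seq.
  by move=> Ax j _; exact: Ax.
by move=> Ax j; apply: (Ax j); rewrite /= mem_index_enum.
Qed.

Lemma lebesgue_measure_unit_itv : lebesgue_measure (`[0, 1]%classic : set TR) = 1%E.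
Proof. by rewrite lebesgue_measure_itv/= lte_fin ltr01 -EFinB subr0. Qed.

Lemma lebesgue_measure_unit_cube d : mu d ((cube d) : set (d.-tuple TR)) = 1%E.
Proof.
have := @lebesgue_measure_tuple_box R d (fun _ => `[0, 1]%classic)
  (fun _ => measurable_itv _).
rewrite unit_cube_box => ->; rewrite big1// => j _.
exact: lebesgue_measure_unit_itv.
Qed.

Lemma lebesgue_measure_unit_cube_lty d :
  (mu d ((cube d) : set (d.-tuple TR)) < +oo)%E.
Proof. by rewrite lebesgue_measure_unit_cube ltry. Qed.

Lemma bounded_measurable_tnth d (f : TR -> R) (j : 'I_d) :
  bounded_measurable f ->
  bounded_measurable (fun x : d.-tuple TR => f (tnth x j)).
Proof.
move=> [mf [M fM]]; split; last by exists M.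
exact: (measurableT_comp mf (measurable_tnth j)).
Qed.

Lemma bounded_measurable_restrict d (T : measurableType d) (f : T -> R) D :
  measurable D -> bounded_measurable f -> bounded_measurable (f \_ D).
Proof.
move=> mD [mf [M fM]]; split.
  by apply/(measurable_restrictT _ mD); exact: measurable_funTS.
exists M => x; rewrite patchE; case: ifPn => // _.
by rewrite normr0; exact: le_trans (normr_ge0 _) (fM x).
Qed.

(** The measure on tuples of length d + 1 is the image of a product measure under cons, and the
    preimage of the cube is a rectangle; Fubini on that rectangle separates the first coordinate. *)
Lemma Rintegral_unit_cubeS d (f : TR -> R) (g : d.-tuple TR -> R) :
  bounded_measurable f -> bounded_measurable g ->
  \int[mu d.+1]_(x in cube d.+1) (f (thead x) * g [tuple of behead x]) =
  (\int[lebesgue_measure]_(t in `[0, 1]) f t) * \int[mu d]_(x in (cube d)) g x.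
Proof.
move=> bf bg; pose I01 : set TR := `[0, 1]%classic.
have mI : measurable I01 by exact: measurable_itv.
have mC := @measurable_unit_cube d.
pose h (p : TR * d.-tuple TR) := f p.1 * g p.2.
have bh : bounded_measurable h.
  apply: bounded_measurableM.
    case: bf => mf [M fM]; split; last by exists M.
    exact: (measurableT_comp mf measurable_fst).
  case: bg => mg [M gM]; split; last by exists M.
  exact: (measurableT_comp mg measurable_snd).
have mIC := measurableX mI mC.
pose m2 : {sigma_finite_measure set (d.-tuple TR) -> \bar R} := mu d.
pose l : {sigma_finite_measure set TR -> \bar R} := lebesgue_measure.
have ICoo : ((l \x m2)%E (I01 `*` (cube d)) < +oo)%E.
  rewrite product_measure1E//= lebesgue_measure_unit_itv.
  by rewrite lebesgue_measure_unit_cube mul1e ltry.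
have ih : (l \x m2)%E.-integrable (I01 `*` (cube d))%classic (EFin \o h).
  exact: bounded_measurable_integrable.
pose F (x : d.+1.-tuple TR) := f (thead x) * g [tuple of behead x].
have mF : measurable_fun setT (EFin \o F).
  apply/measurable_EFinP; apply: measurable_funM.
    by apply: (measurableT_comp bf.1); exact: measurable_tnth.
  by apply: (measurableT_comp bg.1); exact: measurable_behead.
have Fh : (EFin \o F) \o (@tuple_of_pair R d) = EFin \o h.
  by apply/funext => -[x t]; rewrite /F/= theadE; congr (_ * g _)%:E; exact/val_inj.
have preC : (@tuple_of_pair R d) @^-1` (cube d.+1) = I01 `*` (cube d).
  apply/seteqP; split=> -[x t]/=.
    move=> xt; split; first by have := xt ord0; rewrite /= /I01/= in_itv.
    by move=> j; have := xt (lift ord0 j); rewrite tnthS.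
  move=> [x01 t01] j; case: (unliftP ord0 j) => [i|] ->; last first.
    by move: x01; rewrite /= /I01/= in_itv.
  by rewrite tnthS; exact: t01.
rewrite /Rintegral.
transitivity (fine (\int[(l \x m2)%E]_(p in I01 `*` cube d) (h p)%:E)%E).
  congr fine; rewrite /= /lebesgue_measure_step.
  rewrite (@integral_pushforward _ _ _ _ _ _ (@measurable_tuple_of_pair R d) _
    (cube d.+1) (EFin \o F))//.
  - by rewrite preC Fh.
  - by rewrite preC Fh.
  - exact: measurable_unit_cube.
(* Extending by zero turns integrals over the rectangle into integrals over the whole product space,
   where Fubini is available. *)
have ri : (l \x m2)%E.-integrable setT ((EFin \o h) \_ (I01 `*` (cube d))%classic).
  exact/(integrable_mkcond _ mIC).
rewrite [X in fine X = _]integral_mkcond -(integral12_prod_meas1 ri) /fubini_F.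
pose f1 := f \_ I01; pose g1 := g \_ (cube d).
have bf1 : bounded_measurable (f1 : TR -> R) by exact: bounded_measurable_restrict.
have bg1 : bounded_measurable (g1 : d.-tuple TR -> R).
  exact: bounded_measurable_restrict.
have ig : m2.-integrable setT (EFin \o g1).
  rewrite /g1 -restrict_EFin; apply/(integrable_mkcond _ mC).
  by apply: bounded_measurable_integrable => //; exact: lebesgue_measure_unit_cube_lty.
have if1 : l.-integrable setT (EFin \o f1).
  rewrite /f1 -restrict_EFin; apply/(integrable_mkcond _ mI).
  apply: bounded_measurable_integrable => //.
  by rewrite /l/= lebesgue_measure_unit_itv ltry.
transitivity (fine (\int[l]_x ((f1 x)%:E * \int[m2]_y (g1 y)%:E))%E).
  congr fine; apply: eq_integral => x _; rewrite -integralZl//.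
  apply: eq_integral => y _; rewrite /f1 /g1 !patchE in_setX/=.
  by case: (x \in _); case: (y \in _); rewrite /h//= ?mulr0 ?mul0r// -EFinM ?mulr0 ?mul0r.
have fg : (\int[m2]_y (g1 y)%:E)%E \is a fin_num by exact: integrable_fin_num.
rewrite -(fineK fg) integralZr// fineM//; last exact: integrable_fin_num.
congr (fine _ * fine _).
  rewrite [RHS]integral_mkcond; apply: eq_integral => x _.
  by rewrite /f1 !patchE; case: ifPn.
rewrite fineK// [RHS]integral_mkcond.
by apply: eq_integral => x _; rewrite /g1 !patchE; case: ifPn.
Qed.

Local Open Scope complex_scope.

Lemma complex_integral_unit_cubeS d (f : TR -> R[i]) (g : d.-tuple TR -> R[i]) :
  complex_bounded_measurable f -> complex_bounded_measurable g ->
  cintegral (fun x : d.+1.-tuple TR => f (thead x) * g [tuple of behead x]) =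
  complex_integral lebesgue_measure `[0, 1]%classic f * cintegral g.
Proof.
move=> [rf jf] [rg jg].
have bc (f1 : TR -> R) (g1 : d.-tuple TR -> R) :
    bounded_measurable f1 -> bounded_measurable g1 ->
    bounded_measurable
      (fun x : d.+1.-tuple TR => f1 (thead x) * g1 [tuple of behead x]).
  move=> bf [mg [M gM]]; apply: bounded_measurableM.
    exact: bounded_measurable_tnth.
  split; last by exists M.
  exact: (measurableT_comp mg (@measurable_behead _ _ _)).
have ib (h : d.+1.-tuple TR -> R) : bounded_measurable h ->
    (mu d.+1).-integrable (cube d.+1) (EFin \o h).
  apply: bounded_measurable_integrable; first exact: measurable_unit_cube.
  exact: lebesgue_measure_unit_cube_lty.
have irr := ib _ (bc _ _ rf rg); have ijj := ib _ (bc _ _ jf jg).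
have irj := ib _ (bc _ _ rf jg); have ijr := ib _ (bc _ _ jf rg).
have mC := @measurable_unit_cube d.+1.
rewrite /cintegral /complex_integral; simpc.
rewrite -!Rintegral_unit_cubeS// -RintegralB// -RintegralD//.
by congr (_ +i* _); apply: eq_Rintegral => x _; rewrite ?ReM ?ImM.
Qed.

Lemma complex_bounded_measurable_tnth d (f : TR -> R[i]) (j : 'I_d) :
  complex_bounded_measurable f ->
  complex_bounded_measurable (fun x : d.-tuple TR => f (tnth x j)).
Proof.
by move=> [rf jf]; split;
  [exact: (bounded_measurable_tnth j rf)|exact: (bounded_measurable_tnth j jf)].
Qed.

Lemma cintegral_prod d (f : 'I_d -> TR -> R[i]) :
  (forall j, complex_bounded_measurable (f j)) ->
  cintegral (fun x : d.-tuple TR => \prod_(j < d) f j (tnth x j)) =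
  \prod_(j < d) complex_integral lebesgue_measure `[0, 1]%classic (f j).
Proof.
elim: d f => [|d IH] f bf.
  (* In dimension 0 the measure is a Dirac mass at the empty tuple, so the constant 1 has integral
     1. *)
  rewrite big_ord0 /cintegral.
  under eq_Rintegral do rewrite big_ord0/=.
  under [X in _ +i* X]eq_Rintegral do rewrite big_ord0/=.
  rewrite !Rintegral_cst; [|exact: measurable_unit_cube..].
  rewrite mul0r mul1r.
  have -> : fine (mu 0 (cube 0)) = 1 by rewrite lebesgue_measure_unit_cube.
  by [].
rewrite big_ord_recl -IH//.
rewrite -(@complex_integral_unit_cubeS d (f ord0)
  (fun x => \prod_(j < d) f (lift ord0 j) (tnth x j)))//; last first.
  apply: complex_bounded_measurable_prod => j.
  exact: complex_bounded_measurable_tnth.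
congr cintegral; apply/funext => x; rewrite big_ord_recl; congr (_ * _).
by apply: eq_bigr => j _; rewrite {1}(tuple_eta x) tnthS.
Qed.

End unit_cube.

(** * Worst-case errors of quadrature rules in series spaces *)

Section cmodulus.
Context {R : realType}.
Local Open Scope complex_scope.
Implicit Types x y : R[i].

Lemma cmodulus_ge0 x : 0 <= cmodulus x.
Proof. by case: x => a b; exact: sqrtr_ge0. Qed.

Lemma cmodulus0 : cmodulus (0 : R[i]) = 0.
Proof. exact: ComplexField.Normc.normc0. Qed.

Lemma cmodulus1 : cmodulus (1 : R[i]) = 1.
Proof. exact: ComplexField.Normc.normc1. Qed.

Lemma cmodulusM x y : cmodulus (x * y) = cmodulus x * cmodulus y.
Proof. exact: ComplexField.Normc.normcM. Qed.

Lemma cmodulusN x : cmodulus (- x) = cmodulus x.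
Proof. exact: complex.normcN. Qed.

Lemma cmodulusD x y : cmodulus (x + y) <= cmodulus x + cmodulus y.
Proof. exact: complex.le_normcD. Qed.

Lemma cmodulus_real (r : R) : cmodulus r%:C = `|r|.
Proof. by rewrite /cmodulus /= expr0n/= addr0 sqrtr_sqr. Qed.

Lemma cmodulusJ x : cmodulus x^* = cmodulus x.
Proof. by case: x => a b; rewrite /cmodulus /= sqrrN. Qed.

Lemma sqr_cmodulus x : cmodulus x ^+ 2 = complex.Re x ^+ 2 + complex.Im x ^+ 2.
Proof. by case: x => a b; rewrite /cmodulus/= sqr_sqrtr// addr_ge0 ?sqr_ge0. Qed.

End cmodulus.

Section sums_to.
Context {R : realType} {I : choiceType}.
Local Open Scope complex_scope.
Implicit Types (u v : I -> R[i]) (s t : R[i]).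

Local Instance totally_proper : ProperFilter (@summability.totally I) :=
  @summability.totally_filter I.

Lemma eq_sums_to u v s : u =1 v -> sums_to u s -> sums_to v s.
Proof. by move=> /funext ->. Qed.

Lemma sums_to0 : sums_to (fun _ : I => 0 : R[i]) 0.
Proof.
rewrite /sums_to; under eq_fun do rewrite big1//.
exact: cvg_cst.
Qed.

Lemma sums_toD u v s t : sums_to u s -> sums_to v t ->
  sums_to (fun i => u i + v i) (s + t).
Proof.
move=> us vt; rewrite /sums_to; under eq_fun do rewrite big_split/=.
exact: cvgD.
Qed.

Lemma sums_toZ u s (c : R[i]) : sums_to u s -> sums_to (fun i => c * u i) (c * s).
Proof.
move=> us; rewrite /sums_to; under eq_fun do rewrite -mulr_sumr.
by apply: cvgM => //; exact: cvg_cst.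
Qed.

Lemma sums_to_sum J (r : seq J) (u : J -> I -> R[i]) (s : J -> R[i]) :
  (forall j, sums_to (u j) (s j)) ->
  sums_to (fun i => \sum_(j <- r) u j i) (\sum_(j <- r) s j).
Proof.
move=> us; elim: r => [|j r IH].
  by rewrite big_nil; apply: eq_sums_to sums_to0 => i; rewrite big_nil.
by rewrite big_cons; apply: eq_sums_to (sums_toD (us j) IH) => i; rewrite big_cons.
Qed.

Lemma sums_to_dist u s (e : R) : sums_to u s -> 0 < e ->
  exists A : {fset I}, forall B : {fset I}, (A `<=` B)%fset ->
    cmodulus (s - \sum_(i <- B) u i) < e.
Proof.
move=> us e0; have e0' : 0 < e%:C by rewrite ltcR.
have /cvgrPdist_lt/(_ _ e0') [A _ AB] := us.
by exists A => B /AB /=; rewrite ltcR.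
Qed.

Lemma sums_to_finite u (A : {fset I}) : (forall i, i \notin A -> u i = 0) ->
  sums_to u (\sum_(i <- A) u i).
Proof.
move=> u0; apply/cvgrPdist_lt => e e0; exists A => // B /= AB.
rewrite (big_fset_incl _ AB) ?subrr ?normr0//.
by move=> i _ iA; rewrite u0.
Qed.

End sums_to.

(** Summing the inequality 2 a b <= s w a^2 + b^2 / (s w) gives at most (s + s) / 2. With the bounds
    normalised to 1 and s^2, no square root of a sum appears. *)
Lemma weighted_cauchy_schwarz {R : realType} I (r : seq I) (P : pred I)
    (a b w : I -> R) (s : R) : 0 < s -> (forall i, 0 < w i) ->
  \sum_(i <- r | P i) a i ^+ 2 * w i <= 1 ->
  \sum_(i <- r | P i) b i ^+ 2 / w i <= s ^+ 2 ->
  \sum_(i <- r | P i) a i * b i <= s.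
Proof.
move=> s0 w0 aw bw.
have ab i : a i * b i <= 2^-1 * (s * (a i ^+ 2 * w i) + s^-1 * (b i ^+ 2 / w i)).
  rewrite -subr_ge0.
  have -> : 2^-1 * (s * (a i ^+ 2 * w i) + s^-1 * (b i ^+ 2 / w i)) - a i * b i =
            2^-1 * (s * w i * a i - b i) ^+ 2 * (s^-1 * (w i)^-1).
    by field; rewrite !gt_eqF.
  apply: mulr_ge0; first by rewrite mulr_ge0 ?sqr_ge0 ?invr_ge0 ?ler0n.
  by rewrite mulr_ge0// invr_ge0 ltW.
apply: (le_trans (ler_sum _ (fun i _ => ab i))).
rewrite -mulr_sumr big_split/= -!mulr_sumr.
have : s * (\sum_(i <- r | P i) a i ^+ 2 * w i) +
       s^-1 * (\sum_(i <- r | P i) b i ^+ 2 / w i) <= s * 1 + s^-1 * s ^+ 2.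
  by apply: lerD; apply: ler_wpM2l => //; rewrite ?invr_ge0 ltW.
have -> : s^-1 * s ^+ 2 = s by rewrite expr2 mulKf// gt_eqF.
by lra.
Qed.

Section quadrature.
Context {R : realType} {d : nat}.
Variables (n : nat) (y : nat -> d.-tuple R).

(** Equal weights at arbitrary nodes: both the lattice rule and its tent-transformed shifted version
    are instances up to conversion. *)
Definition quadrature (f : d.-tuple R -> R[i]) : R[i] :=
  n%:R^-1 * \sum_(1 <= k < n.+1) f (y k).

Lemma quadrature_sum I (r : seq I) (a : I -> R[i]) (F : I -> d.-tuple R -> R[i]) :
  quadrature (fun x => \sum_(i <- r) a i * F i x) =
  \sum_(i <- r) a i * quadrature (F i).
Proof.
rewrite /quadrature exchange_big/= mulr_sumr; apply: eq_bigr => i _.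
by rewrite -mulr_sumr mulrCA.
Qed.

Lemma quadrature1 : (0 < n)%N -> quadrature (fun _ => 1) = 1.
Proof.
move=> n0; rewrite /quadrature big_const_nat subn1/= iter_addr_0.
by rewrite mulVf// pnatr_eq0 -lt0n.
Qed.

End quadrature.

Section worst_case_error.
Context {R : realType} {d : nat} {I : choiceType}.
Local Notation TR := (measurableTypeR R).
Local Notation mu := (lebesgue_measure_tuple d).
Local Notation cube := (@unit_cube R d).
Local Open Scope complex_scope.
Variables (phi psi : I -> d.-tuple TR -> R[i]) (w : I -> R) (i0 : I).

(* [cosine_space] and [korobov_space] are convertible to instances of
   [series_space]; [psi] plays the role of the conjugate of [phi]. *)
Definition series_coef (f : d.-tuple R -> R[i]) (i : I) : R[i] :=
  cintegral (fun x => f x * psi i x).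

Definition series_norm (f : d.-tuple R -> R[i]) : \bar R :=
  sqrte (\esum_(i in [set: I]) ((cmodulus (series_coef f i)) ^+ 2 * w i)%:E).

Definition series_space : set (d.-tuple R -> R[i]) :=
  [set f | [/\ square_integrable f, (series_norm f < +oo)%E &
    forall x, unit_cube x -> sums_to (fun i => series_coef f i * phi i x) (f x)]].

Hypothesis bphi : forall i, complex_bounded_measurable (phi i).
Hypothesis bpsi : forall i, complex_bounded_measurable (psi i).
Hypothesis ortho : forall i j, cintegral (fun x => phi i x * psi j x) = (i == j)%:R.
Hypothesis phi0 : forall x, phi i0 x = 1.
Hypothesis psi0 : forall x, psi i0 x = 1.
Hypothesis w_gt0 : forall i, 0 < w i.

Variables (n : nat) (y : nat -> d.-tuple R).
Hypothesis n_gt0 : (0 < n)%N.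
Hypothesis cube_y : forall k, unit_cube (y k).

Local Notation Q := (quadrature n y).

Let E := (\esum_(i in ~` [set i0]) ((cmodulus (Q (phi i))) ^+ 2 / w i)%:E)%E.

Let term_ge0 i : 0 <= (cmodulus (Q (phi i))) ^+ 2 / w i.
Proof. by rewrite divr_ge0 ?sqr_ge0// ltW. Qed.

Let E_ge0 : (0 <= E)%E.
Proof. by apply: esum_ge0 => i _; rewrite lee_fin. Qed.

Lemma series_coef0 f : series_coef f i0 = cintegral f.
Proof.
by rewrite /series_coef; congr cintegral; apply/funext => x; rewrite psi0 mulr1.
Qed.

(* Cauchy-Schwarz on the finite partial sums of the series of [f]. *)
Lemma quadrature_error_le f : series_space f -> (series_norm f <= 1)%E ->
  ((cmodulus (cintegral f - Q f))%:E <= sqrte E)%E.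
Proof.
move=> [_ _ fE] f1; pose c := series_coef f.
have c2 (A : {fset I}) : \sum_(i <- A) (cmodulus (c i)) ^+ 2 * w i <= 1.
  rewrite -lee_fin; apply: (@le_trans _ _ (series_norm f ^+ 2)%E); last first.
    by rewrite expe2 -[leRHS]mule1; apply: lee_pmul => //; exact: sqrte_ge0.
  rewrite sqr_sqrte; last first.
    by apply: esum_ge0 => i _; rewrite lee_fin mulr_ge0 ?sqr_ge0// ltW.
  apply: esum_ge; exists [set` A]; first by split.
  by rewrite fsbig_finite//= set_fsetK -sumEFin.
(* The nodes lie in the cube, where the series of [f] converges to [f] pointwise; this is where the
   choice of representative matters, since [Q] evaluates [f] at points. *)
have Qf : sums_to (fun i => c i * Q (phi i)) (Q f).
  have := sums_toZ (c := n%:R^-1) (sums_to_sum (r := index_iota 1 n.+1)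
    (fun k => fE (y k) (cube_y k))).
  by apply: eq_sums_to => i; rewrite /quadrature -mulr_sumr mulrCA.
move: E_ge0; case EE : E => [e| |]// e0; last first.
  by rewrite leey.
rewrite lee_fin in e0.
rewrite /sqrte lee_fin; apply/ler_addgt0Pr => eps eps0.
(* One half of [eps] pays for truncating the series; the other half keeps [s] positive even when [e]
   is 0, as Cauchy-Schwarz requires here. *)
pose s := Num.sqrt e + eps / 2.
have eps20 : 0 < eps / 2 by rewrite divr_gt0.
have s0 : 0 < s by rewrite ltr_wpDl ?sqrtr_ge0.
have es : e <= s ^+ 2.
  rewrite -[leLHS]sqr_sqrtr// ler_sqr ?nnegrE ?sqrtr_ge0 ?ltW//.
  by rewrite /s; lra.
have [A AB] := sums_to_dist Qf eps20.
(* With [i0] in the partial sum, its term [c i0] (as [Q] is exact on constants) cancels the integral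
   of [f]. *)
pose B := (i0 |` A)%fset.
have {}AB := AB B (fsubsetU1 _ _).
have Bi0 : i0 \in B by exact: fset1U1.
rewrite -series_coef0 -/(c _).
have -> : c i0 - Q f = - (Q f - \sum_(i <- B) c i * Q (phi i)) -
    \sum_(i <- B | i != i0) c i * Q (phi i).
  rewrite (bigD1_seq i0)//= (_ : Q (phi i0) = 1); first by ring.
  by rewrite -(quadrature1 y n_gt0); congr (Q _); apply/funext => x; rewrite phi0.
apply: (le_trans (cmodulusD _ _)).
rewrite !cmodulusN.
have -> : Num.sqrt e + eps = eps / 2 + s by rewrite /s; lra.
apply: lerD; first exact: ltW.
have : \sum_(i <- B | i != i0) cmodulus (c i) * cmodulus (Q (phi i)) <= s.
  apply: weighted_cauchy_schwarz => //.
    apply: le_trans (c2 B); rewrite [leRHS](bigID (fun i => i != i0))/= lerDl.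
    by apply: sumr_ge0 => i _; rewrite mulr_ge0 ?sqr_ge0// ltW.
  apply: le_trans es; rewrite -lee_fin -EE.
  apply: esum_ge; exists [set i | i \in B /\ i != i0].
    split; last by move=> i [_ /eqP].
    by apply: sub_finite_set (finite_fset B) => i [].
  rewrite fsbig_finite/=; last by apply: sub_finite_set (finite_fset B) => i [].
  rewrite -sumEFin le_eqVlt; apply/orP; left; apply/eqP; rewrite -[in LHS]big_filter.
  apply: perm_big; apply: uniq_perm; rewrite ?filter_uniq// => i.
  rewrite mem_filter in_fset_set; last by apply: sub_finite_set (finite_fset B) => j [].
  by rewrite andbC; apply/andP/idP; rewrite inE.
apply: le_trans.
elim/big_ind2: _ => [|x1 x2 y1 y2 h1 h2|i _].
- by rewrite cmodulus0.
- by apply: le_trans (cmodulusD _ _) _; exact: lerD.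
- by rewrite cmodulusM.
Qed.

Lemma complex_bounded_measurable_square_integrable (f : d.-tuple TR -> R[i]) :
  complex_bounded_measurable f -> square_integrable f.
Proof.
move=> [rf jf]; split; [exact: measurable_funTS rf.1|exact: measurable_funTS jf.1|].
have b2 : bounded_measurable (fun x => (cmodulus (f x)) ^+ 2).
  have -> : (fun x => (cmodulus (f x)) ^+ 2) = (fun x =>
      complex.Re (f x) * complex.Re (f x) + complex.Im (f x) * complex.Im (f x)).
    by apply/funext => x; rewrite sqr_cmodulus !expr2.
  by apply: bounded_measurableD; exact: bounded_measurableM.
have /integrableP[_] := bounded_measurable_integrable (mu := mu)
  (@measurable_unit_cube R d) (@lebesgue_measure_unit_cube_lty R d) b2.
apply: le_lt_trans; apply: ge0_le_integral => //.
- exact: measurable_unit_cube.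
- by move=> x _; rewrite lee_fin sqr_ge0.
- by apply/measurable_EFinP; exact: measurable_funTS b2.1.
- by apply/measurable_EFinP; apply: measurableT_comp => //; exact: measurable_funTS b2.1.
- by move=> x _; rewrite lee_fin ler_norm.
Qed.

Section polynomial.
Variables (A : {fset I}) (a : I -> R[i]).
Let f (x : d.-tuple TR) := \sum_(i <- A) a i * phi i x.

Let bterm i : complex_bounded_measurable (fun x => a i * phi i x).
Proof.
by apply: complex_bounded_measurableM => //; exact: complex_bounded_measurable_cst.
Qed.

Lemma series_coef_polynomial i : series_coef f i = if i \in A then a i else 0.
Proof.
rewrite /series_coef.
have -> : (fun x => f x * psi i x) =
          (fun x => \sum_(j <- A) a j * (phi j x * psi i x)).
  apply/funext => x; rewrite /f mulr_suml.
  by apply: eq_bigr => j _; rewrite mulrA.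
have bpp j : complex_bounded_measurable (fun x => phi j x * psi i x).
  exact: complex_bounded_measurableM.
have mC := @measurable_unit_cube R d.
have Coo := @lebesgue_measure_unit_cube_lty R d.
rewrite [LHS](complex_integral_sum mC Coo); last first.
  move=> j; apply: complex_bounded_measurableM => //.
  exact: complex_bounded_measurable_cst.
under eq_bigr => j _.
  rewrite (complex_integralZ mC Coo)//.
  rewrite [complex_integral _ _ _](ortho j i).
  over.
case: ifPn => iA.
  rewrite (bigD1_seq i)//= eqxx mulr1 big1 ?addr0// => j /negbTE ->.
  by rewrite mulr0.
rewrite big_seq big1// => j jA; case: eqP => [ji|]; last by rewrite mulr0.
by rewrite -ji jA in iA.
Qed.

Lemma series_norm_polynomial : series_norm f =
  sqrte (\sum_(i <- A) (cmodulus (a i)) ^+ 2 * w i)%:E.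
Proof.
rewrite /series_norm; congr sqrte.
transitivity (\esum_(i in [set` A]) ((cmodulus (a i)) ^+ 2 * w i)%:E)%E.
  rewrite [RHS]esum_mkcond; apply: eq_esum => i _.
  rewrite series_coef_polynomial mem_setE; case: ifPn => // _.
  by rewrite cmodulus0 expr0n/= mul0r.
rewrite esum_fset//; last first.
  by move=> i _; rewrite lee_fin mulr_ge0 ?sqr_ge0// ltW.
by rewrite fsbig_finite//= set_fsetK sumEFin.
Qed.

Lemma series_space_polynomial : series_space f.
Proof.
split.
- apply: complex_bounded_measurable_square_integrable.
  exact: complex_bounded_measurable_sum.
- by rewrite series_norm_polynomial ltry.
- move=> x _; rewrite /f (eq_big_seq (fun i => series_coef f i * phi i x)).
    apply: sums_to_finite => i iA.
    by rewrite series_coef_polynomial (negbTE iA) mul0r.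
  by move=> i /= iA; rewrite series_coef_polynomial iA.
Qed.

End polynomial.

(* The bound is approached by the representers
   [\sum_(i <- A) (Q (phi i))^* / w i *: phi i] of [Q] on the finite sets
   [A] of indices avoiding [i0]; no infinite series has to be constructed, and
   the equality also holds when both sides are infinite. *)
Theorem worst_case_error_sqr :
  (worst_case_error series_space series_norm Q ^+ 2 = E)%E.
Proof.
set W := worst_case_error _ _ _.
have WE : (W <= sqrte E)%E.
  apply: ge_ereal_sup => _ /= [f [fs f1] <-].
  exact: quadrature_error_le.
have Wf f : series_space f -> (series_norm f <= 1)%E ->
    ((cmodulus (cintegral f - Q f))%:E <= W)%E.
  by move=> fs f1; apply: ereal_sup_ubound; exists f.
have W0 : (0 <= W)%E.
  have := Wf _ (series_space_polynomial fset0 (fun=> 0)).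
  rewrite series_norm_polynomial big_nil sqrte0 => /(_ lee01).
  by apply: le_trans; rewrite lee_fin cmodulus_ge0.
apply/eqP; rewrite eq_le; apply/andP; split.
  rewrite -[leRHS]sqr_sqrte// !expe2.
  exact: lee_pmul.
(* [E] is a supremum of finite partial sums, so it is enough to bound each of them by the square of
   [W]. *)
apply: ge_ereal_sup => _ /= [X [finX Xi0] <-].
rewrite fsbig_finite//= sumEFin; set A := fset_set X.
have Ai0 : i0 \notin A by apply/negP; rewrite in_fset_set// inE => /Xi0; exact.
set s := \sum_(i <- A) _.
have s_ge0 : 0 <= s by exact: sumr_ge0.
have [s0|s0] := eqVneq s 0; first by rewrite s0 mule_ge0.
have {}s0 : 0 < s by rewrite lt_neqAle eq_sym s0.
(* The conjugate makes every term of [Q f] nonnegative, and dividing by the root of [s] gives [f]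
   norm 1. Its integral is 0 because [i0] is not in [A], so its error is |Q f|, the root of [s]. *)
pose a i : R[i] := (Q (phi i))^*%C * ((w i)^-1 * (Num.sqrt s)^-1)%:C.
pose f x := \sum_(i <- A) a i * phi i x.
have fs : series_space f by exact: series_space_polynomial.
have f1 : series_norm f = 1%E.
  rewrite /f series_norm_polynomial (_ : \sum_(i <- A) _ = 1) ?sqrte1//.
    by rewrite /sqrte sqrtr1.
  have -> : 1 = s * s^-1 by rewrite divff// gt_eqF.
  rewrite {1}/s mulr_suml; apply: eq_bigr => i _.
  rewrite /a cmodulusM cmodulusJ cmodulus_real exprMn real_normK ?num_real//.
  rewrite exprMn !exprVn sqr_sqrtr//.
  by field; rewrite !gt_eqF.
have f0 : cintegral f = 0.
  by rewrite -series_coef0 series_coef_polynomial (negbTE Ai0).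
have Qf : Q f = (Num.sqrt s)%:C.
  rewrite quadrature_sum.
  transitivity (\sum_(i <- A) (((cmodulus (Q (phi i))) ^+ 2 / w i) * (Num.sqrt s)^-1)%:C).
    apply: eq_bigr => i _; rewrite /a sqr_cmodulus.
    case: (Q (phi i)) => p q; simpc => /=.
    by congr (_ +i* _); ring.
  rewrite -rmorph_sum/= -mulr_suml -/s; congr (_%:C).
  rewrite -{1}[s]sqr_sqrtr// expr2 mulfK//.
  by rewrite gt_eqF// sqrtr_gt0.
have := Wf _ fs; rewrite f1 f0 Qf sub0r => /(_ (lexx _)).
rewrite cmodulusN cmodulus_real ger0_norm ?sqrtr_ge0// => sW.
have -> : s%:E = ((Num.sqrt s)%:E * (Num.sqrt s)%:E)%E.
  by rewrite -EFinM -expr2 sqr_sqrtr.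
by apply: lee_pmul => //; rewrite lee_fin sqrtr_ge0.
Qed.

End worst_case_error.

(** * Trigonometric integrals and sums *)

Section trigonometric.
Context {R : realType}.
Local Notation TR := (measurableTypeR R).
Local Open Scope complex_scope.
Implicit Types (a b t : R) (m : int).

Let is_derive_affine a b t : is_derive t 1 (fun t => a * t + b) a.
Proof.
have -> : (fun t => a * t + b) = (a *: id) + cst b by apply/funext.
by apply: is_derive_eq; rewrite addr0 scaler1.
Qed.

Lemma continuous_affine_cos a b : continuous (fun t => cos (a * t + b)).
Proof.
move=> t; apply: (@continuous_comp _ _ _ (fun t => a * t + b)).
  by apply/differentiable_continuous/derivable1_diffP; case: (is_derive_affine a b t).
exact: continuous_cos.
Qed.

Lemma bounded_measurable_cos a b :
  bounded_measurable (fun t : TR => cos (a * t + b)).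
Proof.
split; first by apply: continuous_measurable_fun; exact: continuous_affine_cos.
by exists 1 => t; exact: cos_max.
Qed.

Lemma bounded_measurable_sin a b :
  bounded_measurable (fun t : TR => sin (a * t + b)).
Proof.
have -> : (fun t : TR => sin (a * t + b)) = (fun t => cos (a * t + (b - pi / 2))).
  by apply/funext => t; rewrite addrA cosBpihalf.
exact: bounded_measurable_cos.
Qed.

Lemma Rintegral_cos a b : a != 0 ->
  \int[lebesgue_measure]_(t in `[0, 1]) cos (a * t + b) =
  (sin (a + b) - sin b) / a.
Proof.
move=> a0; pose F t := a^-1 * sin (a * t + b).
have dF t : is_derive t 1 F (cos (a * t + b)).
  have h := is_derive_affine a b t.
  have : is_derive t 1 (sin \o (fun t => a * t + b)) (a *: cos (a * t + b)).
    by apply: is_derive_eq; rewrite mulrC.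
  move=> /(is_deriveZ a^-1).
  by rewrite scalerA mulVf// scale1r.
have cF : continuous F.
  move=> t; apply/differentiable_continuous/derivable1_diffP.
  by case: (dF t).
rewrite /Rintegral (@continuous_FTC2 _ _ F)//.
- by rewrite /F mulr1 mulr0 add0r/= -mulrBr mulrC.
- exact/continuous_subspaceT/continuous_affine_cos.
- split.
  + by move=> t _; case: (dF t).
  + exact/cvg_at_right_filter/cF.
  + exact/cvg_at_left_filter/cF.
- by move=> t _; rewrite derive1E; case: (dF t).
Qed.

Lemma cosDint2pi b m : cos (b + 2 * pi * m%:~R) = cos b.
Proof.
have H (n : nat) (c : R) : cos (c + 2 * pi * n%:R) = cos c.
  rewrite -(periodicn (@cosD2pi R) n c) -[_ *+ n]mulr_natr -[pi *+ 2]mulr_natr.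
  by congr cos; ring.
case: m => n; first exact: H.
by rewrite NegzE mulrNz mulrN -[LHS](H n.+1) -!pmulrn subrK.
Qed.

Lemma sinDint2pi b m : sin (b + 2 * pi * m%:~R) = sin b.
Proof. by rewrite -!cosBpihalf addrAC cosDint2pi. Qed.

Lemma sin_intpi m : sin (pi * m%:~R) = 0 :> R.
Proof.
have H (n : nat) : sin (pi * n%:R) = 0 :> R.
  have := alternatingn (@sinDpi R) n 0; rewrite add0r sin0 mulr0 => <-.
  by rewrite mulr_natr.
case: m => n; first exact: H.
by rewrite NegzE mulrNz mulrN sinN -pmulrn H oppr0.
Qed.

Lemma Rintegral_unit_itv_cst a :
  \int[lebesgue_measure]_(t in (`[0, 1]%classic : set TR)) a = a.
Proof.
rewrite Rintegral_cst; last exact: measurable_itv.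
by rewrite /= lebesgue_measure_itv/= lte_fin ltr01 -EFinB subr0 mulr1.
Qed.

Lemma Rintegral_cos2pi m b :
  \int[lebesgue_measure]_(t in `[0, 1]) cos (2 * pi * m%:~R * t + b) =
  if m == 0 then cos b else 0.
Proof.
case: eqP => [->|/eqP m0].
  under eq_Rintegral do rewrite mulr0 mul0r add0r.
  exact: Rintegral_unit_itv_cst.
rewrite Rintegral_cos ?(addrC _ b) ?sinDint2pi ?subrr ?mul0r//.
by rewrite !mulf_neq0// ?pnatr_eq0 ?intr_eq0// gt_eqF// pi_gt0.
Qed.

(** Over half periods the antiderivative is a sine vanishing at both endpoints; this needs phase 0,
    in contrast with [Rintegral_cos2pi], which rests on periodicity and allows any phase. *)
Lemma Rintegral_cospi m :
  \int[lebesgue_measure]_(t in `[0, 1]) cos (pi * m%:~R * t) =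
  (m == 0)%:R :> R.
Proof.
case: eqP => [->|/eqP m0].
  under eq_Rintegral do rewrite mulr0 mul0r cos0.
  exact: Rintegral_unit_itv_cst.
have pm0 : pi * m%:~R != 0 :> R by rewrite mulf_neq0 ?intr_eq0// gt_eqF// pi_gt0.
have := Rintegral_cos 0 pm0; rewrite addr0 sin_intpi sin0 subrr mul0r => I0.
by rewrite -[RHS]I0; apply: eq_Rintegral => t _; rewrite addr0.
Qed.

Lemma Rintegral_sin2pi m b :
  \int[lebesgue_measure]_(t in `[0, 1]) sin (2 * pi * m%:~R * t + b) =
  if m == 0 then sin b else 0.
Proof.
rewrite -cosBpihalf -Rintegral_cos2pi; apply: eq_Rintegral => t _.
by rewrite addrA cosBpihalf.
Qed.

Lemma cosM a b : cos a * cos b = 2^-1 * (cos (a - b) + cos (a + b)).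
Proof. by rewrite cosB cosD; field. Qed.

Lemma unit_itv_integrable (f : TR -> R) : bounded_measurable f ->
  lebesgue_measure.-integrable (`[0, 1]%classic : set TR) (EFin \o f).
Proof.
apply: bounded_measurable_integrable; first exact: measurable_itv.
by rewrite /= lebesgue_measure_itv/= lte_fin ltr01 -EFinB subr0 ltry.
Qed.

Lemma Rintegral_cosM a1 b1 a2 b2 :
  \int[lebesgue_measure]_(t in `[0, 1]) (cos (a1 * t + b1) * cos (a2 * t + b2)) =
  2^-1 * (\int[lebesgue_measure]_(t in `[0, 1]) cos ((a1 - a2) * t + (b1 - b2)) +
          \int[lebesgue_measure]_(t in `[0, 1]) cos ((a1 + a2) * t + (b1 + b2))).
Proof.
have i1 := unit_itv_integrable (bounded_measurable_cos (a1 - a2) (b1 - b2)).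
have i2 := unit_itv_integrable (bounded_measurable_cos (a1 + a2) (b1 + b2)).
have i3 := unit_itv_integrable (bounded_measurableD
  (bounded_measurable_cos (a1 - a2) (b1 - b2))
  (bounded_measurable_cos (a1 + a2) (b1 + b2))).
rewrite -RintegralD//.
rewrite -RintegralZl//.
apply: eq_Rintegral => t _; rewrite cosM.
by congr (_ * (cos _ + cos _)); ring.
Qed.

Lemma expi0 : expi 0 = 1 :> R[i].
Proof. by rewrite /expi cos0 sin0. Qed.

Lemma expiD a b : expi (a + b) = expi a * expi b.
Proof.
by rewrite /expi cosD sinD; simpc; congr (_ +i* _); rewrite addrC.
Qed.

Lemma expi_sum I (r : seq I) (f : I -> R) :
  expi (\sum_(i <- r) f i) = \prod_(i <- r) expi (f i).
Proof. by elim/big_rec2: _ => [|i x y _ <-]; rewrite ?expi0 ?expiD. Qed.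

Lemma expiMn a n : expi (a *+ n) = expi a ^+ n.
Proof.
elim: n => [|n IH]; first by rewrite mulr0n expi0.
by rewrite mulrS expiD IH exprS.
Qed.

Lemma expiDint2pi b m : expi (b + 2 * pi * m%:~R) = expi b.
Proof. by rewrite /expi cosDint2pi sinDint2pi. Qed.

Lemma expi2cos a : expi a + expi (- a) = (2 * cos a)%:C.
Proof.
rewrite /expi cosN sinN; apply/eqP; rewrite eq_complex/=.
by apply/andP; split; apply/eqP; ring.
Qed.

Lemma complex_bounded_measurable_expi a :
  complex_bounded_measurable (fun t : TR => expi (a * t)).
Proof.
split=> /=.
  have -> : (fun t => cos (a * t)) = (fun t => cos (a * t + 0)).
    by apply/funext => t; rewrite addr0.
  exact: bounded_measurable_cos.
have -> : (fun t => sin (a * t)) = (fun t => sin (a * t + 0)).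
  by apply/funext => t; rewrite addr0.
exact: bounded_measurable_sin.
Qed.

Lemma complex_integral_expi m :
  complex_integral lebesgue_measure (`[0, 1]%classic : set TR)
    (fun t => expi (2 * pi * m%:~R * t)) = (m == 0)%:R.
Proof.
rewrite /complex_integral/=.
have := Rintegral_cos2pi m 0; have := Rintegral_sin2pi m 0.
under eq_Rintegral do rewrite addr0; move=> ->.
under eq_Rintegral do rewrite addr0; move=> ->.
by rewrite cos0 sin0; case: (m == 0).
Qed.

(* For [0 < r < n], [cos (2 pi r / n) = 1 - 2 (sin (pi r / n)) ^ 2 < 1]. *)
Lemma expi_eq1 (n : nat) m : (0 < n)%N ->
  expi (2 * pi * (m%:~R / n%:R)) = 1 :> R[i] -> (n%:Z %| m)%Z.
Proof.
move=> n0; have nR : n%:R != 0 :> R by rewrite pnatr_eq0 -lt0n.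
have -> : m%:~R / n%:R = (m %% n)%Z%:~R / n%:R + (m %/ n)%Z%:~R :> R.
  rewrite {1}(divz_eq m n%:Z) intrD intrM mulrDl -[n%:Z%:~R]/(n%:R : R).
  by rewrite mulfK// addrC.
rewrite mulrDr expiDint2pi => -[+ _]; apply: contra_eqT => nm.
set r := (m %% n)%Z; have r0 : r != 0 by apply: contra nm => /eqP/dvdz_mod0P.
have r_gt0 : 0 < r by rewrite lt_neqAle eq_sym r0 modz_ge0// eqz_nat -lt0n.
have r_lt : r < n%:Z by rewrite ltz_pmod// ltz_nat.
have -> : 2 * pi * (r%:~R / n%:R) = pi * (r%:~R / n%:R) *+ 2 :> R.
  by rewrite -mulr_natl; ring.
have s0 : 0 < sin (pi * (r%:~R / n%:R) : R).
  apply: sin_gt0_pi; rewrite mulr_gt0 ?pi_gt0 ?divr_gt0 ?ltr0z ?ltr0n//=.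
  rewrite gtr_pMr ?pi_gt0// ltr_pdivrMr ?ltr0n// mul1r.
  by rewrite (_ : n%:R = n%:Z%:~R)// ltr_int.
rewrite cos_mulr2n cos2sin2; apply/eqP => h.
have : sin (pi * (r%:~R / n%:R) : R) ^+ 2 = 0 by lra.
by apply/eqP; rewrite sqrf_eq0 gt_eqF.
Qed.

Lemma character_sum (n : nat) m : (0 < n)%N ->
  n%:R^-1 * \sum_(1 <= i < n.+1) expi (2 * pi * (i%:R * m%:~R / n%:R)) =
  ((n%:Z %| m)%Z)%:R :> R[i].
Proof.
move=> n0; set e := expi (2 * pi * (m%:~R / n%:R)) : R[i].
have nC : n%:R != 0 :> R[i] by rewrite pnatr_eq0 -lt0n.
have nR : n%:R != 0 :> R by rewrite pnatr_eq0 -lt0n.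
have -> : \sum_(1 <= i < n.+1) expi (2 * pi * (i%:R * m%:~R / n%:R)) =
          \sum_(1 <= i < n.+1) e ^+ i.
  by apply: eq_bigr => i _; rewrite -expiMn; congr expi; rewrite -[RHS]mulr_natl; ring.
have en : e ^+ n = 1.
  have : 2 * pi * (m%:~R / n%:R) *+ n = 0 + 2 * pi * m%:~R :> R.
    by rewrite -[LHS]mulr_natr; field.
  by rewrite -expiMn => ->; rewrite expiDint2pi expi0.
case: (boolP (n%:Z %| m)%Z) => [/dvdzP[q mq]|nm].
  have -> : e = 1.
    rewrite /e mq intrM -pmulrn mulfK// -[2 * _ * _]add0r expiDint2pi.
    exact: expi0.
  under eq_bigr do rewrite expr1n.
  by rewrite big_const_nat subn1/= iter_addr_0 mulVf.
have e1 : e != 1 by apply: contra nm => /eqP; exact: expi_eq1.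
suff -> : \sum_(1 <= i < n.+1) e ^+ i = 0 by rewrite mulr0.
(* Geometric sum: multiplying by the nonzero [e - 1] gives e (e^n - 1) = 0, the extra factor [e]
   being due to the sum starting at 1. *)
apply/eqP; rewrite -(mulrI_eq0 _ (x := e - 1)); last first.
  by apply/lregP; rewrite subr_eq0.
rewrite big_add1/= big_mkord; under eq_bigr do rewrite exprS.
by rewrite -mulr_sumr mulrCA -subrX1 en subrr mulr0.
Qed.

Lemma frac_itv t : 0 <= Defs.frac t < 1.
Proof.
have /andP[h1 h2] := real_floor_itv (num_real t); rewrite intrD in h2.
by rewrite /Defs.frac; apply/andP; split; lra.
Qed.

Lemma tent1_itv t : 0 <= t <= 1 -> 0 <= tent1 t <= 1.
Proof.
move=> /andP[t0 t1]; rewrite /tent1 subr_ge0 gerBl normr_ge0 andbT.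
by rewrite ler_norml; apply/andP; split; lra.
Qed.

(** The tent map is 2x on the left half and 2 - 2x on the right half; there the cosine is even and
    the extra 2 shifts its argument by a multiple of 2 pi. The result has period 1 in x, so the
    fractional part disappears as well. *)
Lemma cos_tent (k : nat) t :
  cos (pi * k%:R * tent1 (Defs.frac t)) = cos (2 * pi * k%:R * t).
Proof.
have -> : cos (2 * pi * k%:R * t) = cos (2 * pi * k%:R * Defs.frac t).
  rewrite -[RHS](cosDint2pi _ (k%:Z * Num.floor t)) intrM -pmulrn /Defs.frac.
  by congr cos; ring.
rewrite /tent1; have [h|h] := lerP 0 (2 * Defs.frac t - 1).
  rewrite ger0_norm// -[RHS]cosN -[RHS](cosDint2pi _ k) -pmulrn.
  by congr cos; ring.
by rewrite ltr0_norm//; congr cos; ring.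
Qed.

End trigonometric.

(** * Fourier and cosine bases *)

Section tensor_bases.
Context {R : realType} {d : nat}.
Local Notation TR := (measurableTypeR R).
Local Open Scope complex_scope.

Lemma prod_eqtuple (T : eqType) (h g : d.-tuple T) :
  \prod_(j < d) (tnth h j == tnth g j)%:R = (h == g)%:R :> R[i].
Proof.
have [->|hg] := eqVneq h g; first by rewrite big1// => j _; rewrite eqxx.
have [j hgj] : exists j, tnth h j != tnth g j.
  apply/existsP; apply: contraNT hg => /existsPn hg.
  by apply/eqP/eq_from_tnth => j; apply/eqP; have := hg j; rewrite negbK.
by rewrite (bigD1 j)//= (negbTE hgj) mul0r.
Qed.

Lemma nnzE (h : d.-tuple int) : nnz h = (\sum_(j < d) (tnth h j != 0%R))%N.
Proof.
rewrite /nnz -sum1_count big_mkcond big_tuple.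
by apply: eq_bigr => j _; case: ifP.
Qed.

Lemma expr_nnz (S : comPzSemiRingType) (s : S) (h : d.-tuple int) :
  s ^+ nnz h = \prod_(j < d) s ^+ (tnth h j != 0).
Proof. by rewrite nnzE prodrXr. Qed.

Lemma weight1_gt0 (alpha g : R) (k : int) : 0 < g -> 0 < weight1 alpha g k.
Proof.
move=> g0; rewrite /weight1; case: eqP => // /eqP k0.
by rewrite divr_gt0// powR_gt0// ltr0n absz_gt0.
Qed.

Lemma weight_gt0 (alpha : R) (gamma : nat -> R) (h : d.-tuple int) :
  (forall j, 0 < gamma j) -> 0 < weight alpha gamma h.
Proof. by move=> g0; apply: prodr_gt0 => j _; exact: weight1_gt0. Qed.

Lemma weight_half (alpha : R) (gamma : nat -> R) (h : d.-tuple int) :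
  weight alpha (fun j => gamma j / 2) h = 2 ^+ nnz h * weight alpha gamma h.
Proof.
rewrite expr_nnz /weight -big_split/=; apply: eq_bigr => j _.
rewrite /weight1; case: eqP => _; first by rewrite mulr1.
by rewrite expr1 invf_div [RHS]mulrCA.
Qed.

Lemma fourier_prod (h : d.-tuple int) (x : d.-tuple R) :
  expi (2 * pi * dot h x) =
  \prod_(j < d) expi (2 * pi * (tnth h j)%:~R * tnth x j).
Proof.
by rewrite /dot mulr_sumr expi_sum; apply: eq_bigr => j _; rewrite mulrA.
Qed.

Lemma fourier_conj_prod (h : d.-tuple int) (x : d.-tuple R) :
  expi (- (2 * pi * dot h x)) =
  \prod_(j < d) expi (2 * pi * (- tnth h j)%:~R * tnth x j).
Proof.
rewrite /dot mulr_sumr -sumrN expi_sum; apply: eq_bigr => j _.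
by rewrite mulrNz; congr expi; ring.
Qed.

Lemma complex_bounded_measurable_tensor (f : 'I_d -> TR -> R[i]) :
  (forall j, complex_bounded_measurable (f j)) ->
  complex_bounded_measurable (fun x : d.-tuple TR => \prod_(j < d) f j (tnth x j)).
Proof.
move=> bf; apply: complex_bounded_measurable_prod => j.
exact: complex_bounded_measurable_tnth.
Qed.

Lemma complex_bounded_measurable_fourier (h : d.-tuple int) :
  complex_bounded_measurable (fun x : d.-tuple TR => expi (2 * pi * dot h x)).
Proof.
under eq_fun do rewrite fourier_prod.
apply: (@complex_bounded_measurable_tensor
  (fun j t => expi (2 * pi * (tnth h j)%:~R * t))) => j.
exact: complex_bounded_measurable_expi.
Qed.

Lemma complex_bounded_measurable_fourier_conj (h : d.-tuple int) :
  complex_bounded_measurable (fun x : d.-tuple TR => expi (- (2 * pi * dot h x))).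
Proof.
under eq_fun do rewrite fourier_conj_prod.
apply: (@complex_bounded_measurable_tensor
  (fun j t => expi (2 * pi * (- tnth h j)%:~R * t))) => j.
exact: complex_bounded_measurable_expi.
Qed.

Lemma fourier_orthonormal (h g : d.-tuple int) :
  cintegral (fun x : d.-tuple R =>
    expi (2 * pi * dot h x) * expi (- (2 * pi * dot g x))) = (h == g)%:R.
Proof.
pose f (j : 'I_d) (t : TR) : R[i] := expi (2 * pi * (tnth h j - tnth g j)%:~R * t).
transitivity (cintegral (fun x : d.-tuple TR => \prod_(j < d) f j (tnth x j))).
  congr cintegral; apply/funext => x.
  rewrite fourier_prod fourier_conj_prod -big_split/=; apply: eq_bigr => j _.
  by rewrite -expiD /f; congr expi; rewrite intrD; ring.
rewrite cintegral_prod; last by move=> j; exact: complex_bounded_measurable_expi.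
rewrite -prod_eqtuple; apply: eq_bigr => j _.
by rewrite complex_integral_expi subr_eq0.
Qed.

Lemma complex_bounded_measurable_real dT (T : measurableType dT) (f : T -> R) :
  bounded_measurable f -> complex_bounded_measurable (fun t => (f t)%:C).
Proof. by move=> bf; split => //=; exact: bounded_measurable_cst. Qed.

Lemma complex_integral_real (f : TR -> R) :
  complex_integral lebesgue_measure (`[0, 1]%classic : set TR)
    (fun t => (f t)%:C) = (\int[lebesgue_measure]_(t in `[0, 1]) f t)%:C.
Proof. by rewrite /complex_integral/= Rintegral_unit_itv_cst. Qed.

Let cosine1 (k : nat) (t : R) : R := Num.sqrt 2 ^+ (k != 0)%N * cos (pi * k%:R * t).

Lemma cosine_prod (k : d.-tuple nat) (x : d.-tuple R) :
  (cosine_basis k x)%:C = \prod_(j < d) (cosine1 (tnth k j) (tnth x j))%:C.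
Proof.
rewrite -rmorph_prod/= big_split/= /cosine_basis expr_nnz; congr ((_ * _)%:C).
by apply: eq_bigr => j _; rewrite tnth_map.
Qed.

Let bounded_measurable_cosine1 k : bounded_measurable (cosine1 k : TR -> R).
Proof.
apply: bounded_measurableM; first exact: bounded_measurable_cst.
have -> : (fun t => cos (pi * k%:R * t)) = (fun t => cos (pi * k%:R * t + 0)) :> (R -> R).
  by apply/funext => t; rewrite addr0.
exact: bounded_measurable_cos.
Qed.

Lemma complex_bounded_measurable_cosine (k : d.-tuple nat) :
  complex_bounded_measurable (fun x : d.-tuple TR => (cosine_basis k x)%:C).
Proof.
under eq_fun do rewrite cosine_prod.
apply: (@complex_bounded_measurable_tensor
  (fun j t => (cosine1 (tnth k j) t)%:C)) => j.
exact: complex_bounded_measurable_real.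
Qed.

(** The product-to-sum formula gives half of [k = l] + [k = l = 0]. For k = l = 0 both brackets
    count and the normalisation is 1; for k = l nonzero only the first counts and the two square
    roots supply the missing 2. *)
Let cosine1_orthonormal (k l : nat) :
  \int[lebesgue_measure]_(t in `[0, 1]) (cosine1 k t * cosine1 l t) = (k == l)%:R.
Proof.
have s2 : Num.sqrt 2 ^+ 2 = 2 :> R by rewrite sqr_sqrtr.
pose c := Num.sqrt 2 ^+ (k != 0)%N * Num.sqrt 2 ^+ (l != 0)%N : R.
transitivity (c * (2^-1 * ((k%:Z - l%:Z == 0)%:R + (k%:Z + l%:Z == 0)%:R)) : R).
  rewrite -!Rintegral_cospi.
  have := @Rintegral_cosM R (pi * k%:R) 0 (pi * l%:R) 0.
  rewrite subrr addr0 => h.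
  transitivity (c * \int[lebesgue_measure]_(t in `[0, 1])
      (cos (pi * k%:R * t + 0) * cos (pi * l%:R * t + 0))).
    rewrite -RintegralZl//; last first.
      by apply/unit_itv_integrable/bounded_measurableM; exact: bounded_measurable_cos.
    by apply: eq_Rintegral => t _; rewrite /cosine1 /c !addr0; ring.
  rewrite h; congr (_ * (_ * (_ + _))); apply: eq_Rintegral => t _; rewrite addr0.
    by rewrite intrB -!pmulrn; congr cos; ring.
  by rewrite intrD -!pmulrn; congr cos; ring.
have -> : (k%:Z - l%:Z == 0) = (k == l) by rewrite subr_eq0.
have -> : (k%:Z + l%:Z == 0) = (k == 0)%N && (l == 0)%N by rewrite -addn_eq0.
rewrite /c; have [<-|kl] := eqVneq k l.
  case: (k == 0)%N => /=; rewrite ?expr0 ?expr1; first by field.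
  by rewrite -expr2 s2; field.
have -> : (k == 0)%N && (l == 0)%N = false.
  by apply: contraNF kl => /andP[/eqP-> /eqP->].
by rewrite addr0 !mulr0.
Qed.

Lemma cosine_orthonormal (k l : d.-tuple nat) :
  cintegral (fun x : d.-tuple R => (cosine_basis k x)%:C * (cosine_basis l x)%:C) =
  (k == l)%:R.
Proof.
pose f (j : 'I_d) (t : TR) : R[i] := (cosine1 (tnth k j) t * cosine1 (tnth l j) t)%:C.
transitivity (cintegral (fun x : d.-tuple TR => \prod_(j < d) f j (tnth x j))).
  congr cintegral; apply/funext => x; rewrite !cosine_prod -big_split/=.
  by apply: eq_bigr => j _; rewrite /f [RHS]rmorphM; reflexivity.
rewrite cintegral_prod; last first.
  by move=> j; apply/complex_bounded_measurable_real/bounded_measurableM.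
rewrite -prod_eqtuple; apply: eq_bigr => j _.
by rewrite complex_integral_real cosine1_orthonormal; case: eqP.
Qed.

End tensor_bases.

(** * The lattice rule in the Korobov space *)

Section korobov.
Context {R : realType} {d n : nat}.
Variables (z : d.-tuple 'I_n) (alpha : R) (gamma : nat -> R).
Hypotheses (n_gt0 : (0 < n)%N) (gamma_gt0 : forall j, 0 < gamma j).
Local Open Scope complex_scope.

Let s (h : d.-tuple int) : int := \sum_(j < d) tnth h j * (tnth z j)%:Z.

Lemma fourier_lattice_point (h : d.-tuple int) (i : nat) :
  expi (2 * pi * dot h [tuple Defs.frac (i%:R * (tnth z j)%:R / n%:R) | j < d]) =
  expi (2 * pi * (i%:R * (s h)%:~R / n%:R)) :> R[i].
Proof.
(* The integer parts removed by [frac], paired with [h]: they change the angle by an integer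
   multiple of 2 pi. *)
pose m : int := \sum_(j < d) tnth h j * Num.floor (i%:R * (tnth z j)%:R / n%:R : R).
rewrite -[LHS](expiDint2pi _ m); congr expi.
rewrite -mulrDr; congr (_ * _); rewrite /dot /s /m !rmorph_sum/= -big_split/=.
rewrite mulr_sumr mulr_suml; apply: eq_bigr => j _.
by rewrite tnth_mktuple /Defs.frac !intrM -pmulrn; ring.
Qed.

Lemma quadrature_fourier (h : d.-tuple int) :
  lattice_rule z (fun x => expi (2 * pi * dot h x)) =
  ((n%:Z %| s h)%Z)%:R :> R[i].
Proof.
rewrite -(character_sum _ n_gt0) /lattice_rule; congr (_ * _).
by apply: eq_bigr => i _; exact: fourier_lattice_point.
Qed.

Lemma korobov_wce_sqr :
  (korobov_wce alpha (fun j => (gamma j / 2)%R) (@lattice_rule R d n z) ^+ 2 =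
  \esum_(k in [set k | dual_lattice z k /\ k <> [tuple 0%R | _ < d]])
    (2 ^- nnz k / weight alpha gamma k)%:E)%E.
Proof.
have dot0 (x : d.-tuple R) : dot [tuple 0%R | _ < d] x = 0.
  by rewrite /dot big1// => j _; rewrite tnth_mktuple mul0r.
have := @worst_case_error_sqr R d _ (fun h x => expi (2 * pi * dot h x))
  (fun h x => expi (- (2 * pi * dot h x))) (weight alpha (fun j => gamma j / 2))
  [tuple 0%R | _ < d] (@complex_bounded_measurable_fourier R d)
  (@complex_bounded_measurable_fourier_conj R d) (@fourier_orthonormal R d)
  _ _ _ n (fun i => [tuple Defs.frac (i%:R * (tnth z j)%:R / n%:R) | j < d])
  n_gt0 _.
rewrite -[quadrature _ _]/(lattice_rule z) => ->.
- rewrite [in RHS](_ : [set k | _] = ~` [set [tuple 0%R | _ < d]] `&` dual_lattice z);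
    last by apply/seteqP; split=> h [].
  rewrite esum_mkcondr; apply: eq_esum => h _.
  rewrite quadrature_fourier weight_half invfM.
  case: ifPn; rewrite ?inE ?notin_setE /dual_lattice/= => hz.
    by rewrite hz cmodulus1 expr1n mul1r.
  by rewrite (negbTE (introN idP hz)) cmodulus0 expr0n mul0r.
- by move=> x; rewrite dot0 mulr0 expi0.
- by move=> x; rewrite dot0 mulr0 oppr0 expi0.
- by move=> h; apply: weight_gt0 => j; rewrite divr_gt0.
- move=> i j; rewrite tnth_mktuple.
  by have /andP[-> /ltW] := @frac_itv R (i%:R * (tnth z j)%:R / n%:R).
Qed.

End korobov.

(** * Averaging over the shift *)

Section signs.
Context {R : realType} {d : nat}.
Local Open Scope complex_scope.
Implicit Types (k : d.-tuple nat) (e : {ffun 'I_d -> bool}).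

Definition signed k e : d.-tuple int :=
  [tuple (-1) ^+ e j * (tnth k j)%:Z | j < d].

(* The sign of a zero entry is normalised to [+], so that [signed] is a
   bijection from the pairs [(k, e)] with [e] in [sign_family k] to the
   integer tuples. *)
Definition sign_family k :=
  family (fun j => [pred b : bool | (tnth k j == 0%N) ==> ~~ b]).

(** Each nonzero entry contributes 2 cos t = e^(it) + e^(-it), one exponential per sign. A zero
    entry has no factor 2 and a single admissible sign, and its angle must vanish for the cosine to
    equal the one exponential. Distributing the product over these sums gives the sum over sign
    patterns. *)
Lemma prod_cos_signs k (theta : 'I_d -> R) :
  (forall j, tnth k j = 0%N -> theta j = 0) ->
  2 ^+ nnz (tuple_int k) * \prod_(j < d) (cos (theta j))%:C =
  \sum_(e in sign_family k) \prod_(j < d) expi ((-1) ^+ e j * theta j).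
Proof.
move=> theta0; rewrite /sign_family -(bigA_distr_big_dep _
  (fun (j : 'I_d) (b : bool) => expi ((-1) ^+ b * theta j))).
rewrite expr_nnz -big_split/=; apply: eq_bigr => j _.
rewrite tnth_map [RHS]big_mkcond big_bool/=.
have [k0|k0] := eqVneq (tnth k j) 0%N; rewrite ?k0/=.
  by rewrite theta0// mulr0 expi0 cos0 expr0 mul1r add0r.
rewrite expr1 expr0 mulN1r mul1r.
by rewrite addrC expi2cos rmorphM/= rmorph_nat.
Qed.

End signs.

Section shift_average.
Context {R : realType} {d n : nat}.
Variables (z : d.-tuple 'I_n).
Hypothesis n_gt0 : (0 < n)%N.
Local Notation TR := (measurableTypeR R).
Local Notation mu := (@lebesgue_measure_tuple R d).
Local Notation cube := (@unit_cube R d).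
Local Open Scope complex_scope.

Definition tent_node (Delta : d.-tuple R) (i : nat) : d.-tuple R :=
  tent [tuple Defs.frac (i%:R * (tnth z j)%:R / n%:R + tnth Delta j) | j < d].

Lemma unit_cube_tent_node Delta i : unit_cube (tent_node Delta i).
Proof.
move=> j; rewrite tnth_map tnth_mktuple; apply: tent1_itv.
by have /andP[-> /ltW ->] := frac_itv (i%:R * (tnth z j)%:R / n%:R + tnth Delta j).
Qed.

Let angle (k : d.-tuple nat) (j : 'I_d) (i : nat) : R :=
  2 * pi * (tnth k j)%:R * (i%:R * (tnth z j)%:R / n%:R).

Let node_factor k j i (t : R) : R :=
  Num.sqrt 2 ^+ (tnth k j != 0)%N * cos (2 * pi * (tnth k j)%:R * t + angle k j i).

Lemma cosine_basis_tent_node k Delta i :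
  cosine_basis k (tent_node Delta i) = \prod_(j < d) node_factor k j i (tnth Delta j).
Proof.
rewrite /cosine_basis expr_nnz -big_split/=; apply: eq_bigr => j _.
rewrite !tnth_map tnth_ord_tuple cos_tent; congr (_ * cos _).
by rewrite /angle; ring.
Qed.

Definition tent_quadrature (k : d.-tuple nat) (Delta : d.-tuple TR) : R :=
  n%:R^-1 * \sum_(1 <= i < n.+1) cosine_basis k (tent_node Delta i).

Lemma quadrature_cosine k Delta :
  quadrature n (tent_node Delta) (fun x => (cosine_basis k x)%:C) =
  (tent_quadrature k Delta)%:C.
Proof.
by rewrite /quadrature /tent_quadrature rmorphM/= fmorphV rmorph_nat rmorph_sum.
Qed.

Let bounded_measurable_node_factor k j i :
  bounded_measurable (node_factor k j i : TR -> R).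
Proof.
apply: bounded_measurableM; first exact: bounded_measurable_cst.
exact: bounded_measurable_cos.
Qed.

Lemma bounded_measurable_tent_quadrature k :
  bounded_measurable (tent_quadrature k).
Proof.
(* The detour through complex values makes the closure properties of sums and tensor products
   applicable. *)
suff [] : complex_bounded_measurable (fun Delta => (tent_quadrature k Delta)%:C).
  by [].
have -> : (fun Delta => (tent_quadrature k Delta)%:C) = (fun Delta =>
    n%:R^-1%:C * \sum_(1 <= i < n.+1)
      \prod_(j < d) (node_factor k j i (tnth Delta j))%:C).
  apply/funext => Delta; rewrite /tent_quadrature rmorphM/= rmorph_sum/=.
  congr (_ * _); apply: eq_bigr => i _.
  by rewrite cosine_basis_tent_node rmorph_prod.
apply: complex_bounded_measurableM; first exact: complex_bounded_measurable_cst.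
apply: complex_bounded_measurable_sum => i.
apply: (@complex_bounded_measurable_tensor _ _
  (fun j t => (node_factor k j i t)%:C)) => j.
exact: complex_bounded_measurable_real.
Qed.

(** Of the two cosines in the product-to-sum formula, the difference is constant in the shift and
    the sum has frequency 2 k_j, hence mean 0 unless k_j = 0. For nonzero k_j the normalisation 2
    cancels the 1/2; for k_j = 0 both angles vanish and both sides are 1. *)
Let Rintegral_node_factorM k j i l :
  \int[lebesgue_measure]_(t in `[0, 1]) (node_factor k j i t * node_factor k j l t) =
  cos (angle k j i - angle k j l).
Proof.
have s2 : Num.sqrt 2 ^+ 2 = 2 :> R by rewrite sqr_sqrtr.
pose c := Num.sqrt 2 ^+ (tnth k j != 0)%N * Num.sqrt 2 ^+ (tnth k j != 0)%N : R.
have := Rintegral_cosM (2 * pi * (tnth k j)%:R) (angle k j i)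
  (2 * pi * (tnth k j)%:R) (angle k j l).
rewrite subrr; under [X in _ = _ * (X + _) -> _]eq_Rintegral do rewrite mul0r add0r.
rewrite Rintegral_unit_itv_cst.
have := Rintegral_cos2pi ((tnth k j)%:Z + (tnth k j)%:Z) (angle k j i + angle k j l).
rewrite intrD -!pmulrn mulrDr => -> h.
transitivity (c * \int[lebesgue_measure]_(t in `[0, 1])
    (cos (2 * pi * (tnth k j)%:R * t + angle k j i) *
     cos (2 * pi * (tnth k j)%:R * t + angle k j l))).
  rewrite -RintegralZl//; last first.
    by apply/unit_itv_integrable/bounded_measurableM; exact: bounded_measurable_cos.
  by apply: eq_Rintegral => t _; rewrite /node_factor /c; ring.
rewrite h /c -PoszD.
have -> : (((tnth k j + tnth k j)%N : int) == 0) = (tnth k j == 0)%N.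
  by rewrite eqz_nat addnn double_eq0.
case: eqP => [k0|_] /=.
  by rewrite /angle k0 !(mulr0, mul0r) subrr addr0 cos0 expr0; field.
by rewrite addr0 expr1 -expr2 s2 mulrA divff ?mul1r// pnatr_eq0.
Qed.

Let signed_dot (k : d.-tuple nat) (e : {ffun 'I_d -> bool}) : int :=
  \sum_(j < d) tnth (signed k e) j * (tnth z j)%:Z.

(** Once the cosines are exponentials, the dependence on the two nodes separates, so the double sum
    over nodes becomes a product of two character sums. *)
Let prod_expi_angle k (e : {ffun 'I_d -> bool}) (i l : nat) :
  \prod_(j < d) expi ((-1) ^+ e j * (angle k j i - angle k j l)) =
  expi (2 * pi * (i%:R * (signed_dot k e)%:~R / n%:R)) *
  expi (2 * pi * (l%:R * (- signed_dot k e)%:~R / n%:R)) :> R[i].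
Proof.
rewrite -expiD -expi_sum; congr expi; rewrite -mulrDr -mulrDl.
rewrite rmorphN/= mulrN -mulrBl /signed_dot rmorph_sum/=.
rewrite mulr_sumr mulr_suml mulr_sumr; apply: eq_bigr => j _.
rewrite tnth_mktuple /angle !intrM rmorphXn/= rmorphN1 -!pmulrn.
by ring.
Qed.

Lemma Rintegral_tent_quadrature_sqr k :
  \int[mu]_(Delta in cube) (tent_quadrature k Delta ^+ 2) =
  2 ^- nnz (tuple_int k) *
  \sum_(e in sign_family k)
    ((n%:Z %| \sum_(j < d) tnth (signed k e) j * (tnth z j)%:Z)%Z)%:R.
Proof.
have mC := @measurable_unit_cube R d.
have Coo := @lebesgue_measure_unit_cube_lty R d.
(* The identity is real, but its proof expands cosines into complex exponentials. *)
apply: (@complexI R).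
transitivity (cintegral (fun Delta : d.-tuple TR => (tent_quadrature k Delta ^+ 2)%:C)).
  rewrite /cintegral/=; congr (_ +i* _).
  by rewrite Rintegral_cst ?mul0r.
pose g i l j (t : TR) : R[i] := (node_factor k j i t * node_factor k j l t)%:C.
have bg i l j : complex_bounded_measurable (g i l j).
  exact/complex_bounded_measurable_real/bounded_measurableM.
pose G i l (Delta : d.-tuple TR) := \prod_(j < d) g i l j (tnth Delta j).
have bG i l : complex_bounded_measurable (G i l).
  exact: complex_bounded_measurable_tensor.
pose c : R[i] := n%:R^-1 * n%:R^-1.
transitivity (cintegral (fun Delta : d.-tuple TR =>
    c * \sum_(1 <= i < n.+1) \sum_(1 <= l < n.+1) G i l Delta)).
  congr cintegral; apply/funext => Delta.
  rewrite /tent_quadrature expr2 mulrACA big_distrlr/= !rmorphM/= fmorphV rmorph_nat.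
  congr (_ * _); rewrite rmorph_sum; apply: eq_bigr => i _.
  rewrite rmorph_sum; apply: eq_bigr => l _.
  rewrite !cosine_basis_tent_node -big_split rmorph_prod.
  by apply: eq_bigr.
rewrite [LHS](complex_integralZ mC Coo); last first.
  by apply: complex_bounded_measurable_sum => i; exact: complex_bounded_measurable_sum.
rewrite (complex_integral_sum mC Coo); last first.
  by move=> i; exact: complex_bounded_measurable_sum.
under eq_bigr do rewrite (complex_integral_sum mC Coo)//.
transitivity (c * \sum_(1 <= i < n.+1) \sum_(1 <= l < n.+1)
   (2 ^- nnz (tuple_int k) * \sum_(e in sign_family k)
     (expi (2 * pi * (i%:R * (signed_dot k e)%:~R / n%:R)) *
      expi (2 * pi * (l%:R * (- signed_dot k e)%:~R / n%:R))))).
  congr (_ * _); apply: eq_bigr => i _; apply: eq_bigr => l _.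
  rewrite [LHS](cintegral_prod (bg i l)).
  under [X in _ = _ * X]eq_bigr do rewrite -prod_expi_angle.
  rewrite -prod_cos_signs.
    rewrite mulKf ?expf_neq0 ?pnatr_eq0//; apply: eq_bigr => j _.
    by rewrite complex_integral_real Rintegral_node_factorM.
  by move=> j k0; rewrite /angle k0 mulr0 !mul0r subrr.
rewrite rmorphM/= fmorphV rmorphXn rmorph_nat rmorph_sum/=.
under eq_bigr do rewrite -mulr_sumr.
rewrite -mulr_sumr mulrCA; congr (_ * _).
pose A (m : int) (i : nat) : R[i] := expi (2 * pi * (i%:R * m%:~R / n%:R)).
transitivity (c * \sum_(e in sign_family k)
    (\sum_(1 <= i < n.+1) A (signed_dot k e) i) *
    (\sum_(1 <= l < n.+1) A (- signed_dot k e) l)).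
  congr (_ * _); under [RHS]eq_bigr do rewrite big_distrlr/=.
  by rewrite [RHS]exchange_big; apply: eq_bigr => i _; exact: exchange_big.
rewrite mulr_sumr; apply: eq_bigr => e _.
(* The two character sums test n | h.z and n | -h.z, which is the same condition; a 0-1 indicator is
   its own square. *)
by rewrite /c mulrACA !character_sum// rpredN rmorph_nat -natrM mulnb andbb.
Qed.

End shift_average.

(** * Unordered sums *)

Section esum.
Context {R : realType}.
Local Open Scope ereal_scope.

(** Enumerating the index type by its codes turns the unordered sum into a series, the form in which
    sums and integrals can be exchanged; naturals that code nothing contribute 0. *)
Lemma esum_count (I : countType) (a : I -> \bar R) : (forall i, 0 <= a i) ->
  \esum_(i in [set: I]) a i = \sum_(m <oo) oapp a 0 (@pickle_inv I m).
Proof.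
move=> a0; pose b m := oapp a 0 (@pickle_inv I m).
have b0 m : 0 <= b m by rewrite /b; case: pickle_inv => /=.
rewrite nneseries_esumT//.
have -> : \esum_(m in [set: nat]) b m = \esum_(m in range (@choice.pickle I)) b m.
  rewrite [RHS]esum_mkcond; apply: eq_esum => m _.
  case: ifPn => // mI; rewrite /b; case E : (@pickle_inv I m) => [i|//] /=.
  exfalso; move/negP : mI; apply; rewrite inE; exists i => //.
  by have := @pickle_invK I m; rewrite E.
rewrite esum_image; last by move=> i j _ _; exact: (pcan_inj choice.pickleK).
by apply: eq_esum => i _; rewrite /b pickleK_inv.
Qed.

Lemma integral_esum d (T : measurableType d) (mu : {measure set T -> \bar R})
    (D : set T) (I : countType) (A : set I) (f : I -> T -> \bar R) :
  measurable D -> (forall i, measurable_fun D (f i)) ->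
  (forall i x, 0 <= f i x) ->
  \int[mu]_(x in D) (\esum_(i in A) f i x) = \esum_(i in A) \int[mu]_(x in D) f i x.
Proof.
move=> mD mf f0; pose g i x := if i \in A then f i x else 0.
have g0 i x : 0 <= g i x by rewrite /g; case: ifP.
have gE i : g i = if i \in A then f i else cst 0.
  by apply/funext => x; rewrite /g; case: ifP.
have mg i : measurable_fun D (g i).
  by rewrite gE; case: ifP => _; [exact: mf|exact: measurable_cst].
pose G m x := oapp (g ^~ x) 0 (@pickle_inv I m).
transitivity (\int[mu]_(x in D) (\sum_(m <oo) G m x)).
  apply: eq_integral => x _; rewrite esum_mkcond esum_count// => i.
  exact: (g0 i x).
rewrite integral_nneseries//; last 2 first.
- move=> m; rewrite /G; case: pickle_inv => [i|] /=; first exact: mg.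
  exact: measurable_cst.
- by move=> m x _; rewrite /G; case: pickle_inv => /=.
rewrite esum_mkcond esum_count.
  apply: eq_eseriesr => m _; rewrite /G; case: pickle_inv => [i|] /=.
    by rewrite gE; case: ifP => // _; rewrite integral0.
  by rewrite integral0.
by move=> i; case: ifP => // _; exact: integral_ge0.
Qed.

Lemma esum_finType (I : finType) (P : pred I) (a : I -> \bar R) :
  (forall i, 0 <= a i) -> \esum_(i in [set` P]) a i = \sum_(i | P i) a i.
Proof.
move=> a0; rewrite esum_fset//.
  rewrite -(@bigfs _ _ _ _ (index_enum I) P) ?index_enum_uniq// => i _.
  by rewrite mem_index_enum.
Qed.

(** Only this direction is needed to bound sums from above, and it follows at once from the finite
    partial sums. *)
Lemma esum_mulr_le (I : choiceType) (A : set I) (a : I -> \bar R) (c : \bar R) :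
  0 <= c -> (forall i, 0 <= a i) ->
  \esum_(i in A) (c * a i) <= c * \esum_(i in A) a i.
Proof.
move=> c0 a0; apply: ge_ereal_sup => _ [X [finX XA] <-].
rewrite fsbig_finite//= -ge0_sume_distrr//; apply: lee_wpmul2l => //.
by apply: esum_ge; exists X => //; rewrite fsbig_finite.
Qed.

End esum.

(** * Integer tuples as natural tuples with signs *)

Section regroup.
Context {R : realType} {d : nat}.

Lemma absz_signed (k : d.-tuple nat) e j : `|tnth (signed k e) j|%N = tnth k j.
Proof. by rewrite tnth_mktuple abszMsign absz_nat. Qed.

Lemma signed_neq0 (k : d.-tuple nat) e j :
  (tnth (signed k e) j != 0) = (tnth k j != 0%N).
Proof. by rewrite -absz_eq0 absz_signed. Qed.

Lemma nnz_signed (k : d.-tuple nat) e : nnz (signed k e) = nnz (tuple_int k).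
Proof.
by rewrite !nnzE; apply: eq_bigr => j _; rewrite signed_neq0 tnth_map.
Qed.

Lemma weight_signed (alpha : R) gamma (k : d.-tuple nat) e :
  weight alpha gamma (signed k e) = weight alpha gamma (tuple_int k).
Proof.
apply: eq_bigr => j _; rewrite /weight1 absz_signed -absz_eq0 absz_signed.
by rewrite tnth_map.
Qed.

Lemma esum_signed (a : d.-tuple int -> \bar R) : (forall h, (0 <= a h)%E) ->
  (\esum_(k in ~` [set [tuple 0%N | _ < d]])
     \sum_(e in sign_family k) a (signed k e) =
   \esum_(h in ~` [set [tuple 0%R | _ < d]]) a h)%E.
Proof.
move=> a0.
under eq_esum do rewrite -esum_finType//.
rewrite esum_esum//; apply/esym.
apply: (reindex_esum _ _
  (fun p : d.-tuple nat * {ffun 'I_d -> bool} => signed p.1 p.2) a); split.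
- move=> [k e] [/= k0 _] h0; apply: k0; apply: eq_from_tnth => j.
  by rewrite -(absz_signed k e) h0 !tnth_mktuple.
- move=> [k e] [l f] /[!inE] -[/= _ /familyP kF] [/= _ /familyP lF] kl.
  have kl' : k = l.
    by apply: eq_from_tnth => j; rewrite -(absz_signed k e) kl absz_signed.
  rewrite -{}kl' in kl lF *; congr pair; apply/ffunP => j.
  have := kF j; have := lF j; rewrite !inE.
  (* At a zero entry the family allows only the sign +; at a nonzero one the sign is read off the
     integer. *)
  have [_|k0] := eqVneq (tnth k j) 0%N; first by case: (e j); case: (f j).
  have := congr1 (fun h => tnth h j) kl; rewrite !tnth_mktuple.
  have kZ : (tnth k j)%:Z != 0 by [].
  by move=> /(mulIf kZ); case: (e j); case: (f j).
(* The preimage consists of absolute values and negativity flags; a zero entry is not negative, as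
   the family requires. *)
- move=> h h0; exists (map_tuple absz h, [ffun j => tnth h j < 0]); last first.
    by apply: eq_from_tnth => j; rewrite tnth_mktuple ffunE tnth_map -intEsign.
  split => /=.
    move=> k0; apply: h0; apply: eq_from_tnth => j; apply/eqP.
    have /eqP := congr1 (fun t => tnth t j) k0.
    by rewrite tnth_map !tnth_mktuple absz_eq0.
  apply/familyP => j; rewrite !inE ffunE tnth_map absz_eq0.
  by apply/implyP => /eqP ->.
Qed.

End regroup.

(** * Convergence of the sum of reciprocal weights *)

Section summability.
Context {R : realType}.

(* Cauchy condensation: there are [2 ^ N] terms, each at most [(2 ^ N)^-s]. *)
Lemma dyadic_block_le (s : R) (N : nat) : 0 <= s ->
  \sum_(2 ^ N <= i < 2 ^ N.+1) (i%:R `^ s)^-1 <= (2 / 2 `^ s) ^+ N.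
Proof.
move=> s0; have p2 : 0 < 2 `^ s :> R by exact: powR_gt0.
apply: (@le_trans _ _ (\sum_(2 ^ N <= i < 2 ^ N.+1) ((2 ^ N)%:R `^ s)^-1)).
  rewrite big_nat_cond [leRHS]big_nat_cond.
  apply: ler_sum => i /andP[/andP[Ni _] _].
  rewrite lef_pV2 ?posrE ?powR_gt0 ?ltr0n ?expn_gt0//; last first.
    by apply: leq_trans Ni; rewrite expn_gt0.
  by apply: ge0_ler_powR; rewrite ?nnegrE ?ler_nat ?ler0n.
have pN : (2 ^ N)%:R `^ s = (2 `^ s) ^+ N :> R.
  by rewrite natrX -powR_mulrn// -powRrM mulrC powRrM powR_mulrn// powR_ge0.
rewrite big_const_nat expnS mul2n -addnn addnK iter_addr_0 pN.
by rewrite -[leLHS]mulr_natl expr_div_n natrX.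
Qed.

Lemma p_series_bounded (s : R) : 1 < s ->
  exists M : R, forall N, \sum_(1 <= i < N) (i%:R `^ s)^-1 <= M.
Proof.
move=> s1; have s0 : 0 <= s by lra.
pose q : R := 2 / 2 `^ s.
have q0 : 0 < q by rewrite divr_gt0// powR_gt0.
(* 2^s = exp (s ln 2) exceeds exp (ln 2) = 2 because s > 1. *)
have q1 : q < 1.
  rewrite ltr_pdivrMr ?powR_gt0// mul1r /powR pnatr_eq0/=.
  by rewrite -[ltLHS]lnK ?posrE// ltr_expR ltr_pMl// ln_gt0// ltr1n.
exists (1 / (1 - q)) => N.
have t0 i : 0 <= (i%:R `^ s)^-1 :> R by rewrite invr_ge0 powR_ge0.
(* Since N <= 2^N, the sum may be prolonged to the end of a dyadic block. *)
apply: (@le_trans _ _ (\sum_(1 <= i < 2 ^ N) (i%:R `^ s)^-1)).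
  case: N => [|N]; first by rewrite big_geq// sumr_ge0.
  rewrite [leRHS](big_cat_nat _ (n := N.+1))//=; last exact/ltnW/ltn_expl.
  by rewrite lerDl sumr_ge0.
apply: (@le_trans _ _ (series (geometric 1 q) N)); last first.
  by apply: geometric_le_lim => //; rewrite ger0_norm// ltW.
elim: N => [|N IH]; first by rewrite big_geq// /series/= big_geq.
rewrite (big_cat_nat _ (n := 2 ^ N))/=; last 2 first.
- by rewrite expn_gt0.
- by rewrite leq_exp2l.
rewrite /series/= big_nat_recr//=; apply: lerD; first exact: IH.
by rewrite mul1r; exact: dyadic_block_le.
Qed.

Local Open Scope ereal_scope.

Lemma nneseries_lty (v : nat -> R) (M : R) : (forall m, 0 <= v m)%R ->
  (forall N, \sum_(0 <= i < N) v i <= M)%R ->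
  \esum_(m in [set: nat]) (v m)%:E < +oo.
Proof.
move=> v0 vM; rewrite -nneseries_esumT; last by move=> m; rewrite lee_fin.
apply: (@le_lt_trans _ _ M%:E); last exact: ltry.
apply: lime_le; first by apply: is_cvg_nneseries => m _ _; rewrite lee_fin.
by apply: nearW => N; rewrite sumEFin lee_fin.
Qed.

(** The nonnegative and the negative integers each give g times a p-series with exponent 2 alpha,
    and the frequency 0 adds a single term 1. *)
Lemma esum_weight1_lty (alpha g : R) : (2^-1 < alpha)%R -> (0 < g)%R ->
  \esum_(m in [set: int]) (weight1 alpha g m)^-1%:E < +oo.
Proof.
move=> alpha1 g0; have s1 : (1 < 2 * alpha)%R by lra.
have [M SM] := p_series_bounded s1.
have M0 : (0 <= M)%R by have := SM 0%N; rewrite big_geq.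
have w0 m : (0 <= (weight1 alpha g m)^-1)%R.
  by rewrite invr_ge0 ltW// weight1_gt0.
have SV N : (\sum_(1 <= i < N) (weight1 alpha g i)^-1 <= g * M)%R.
  rewrite (_ : (\sum_(_ <= i < _) _ = g * \sum_(1 <= i < N) (i%:R `^ (2 * alpha))^-1)%R).
    by apply: ler_wpM2l (SM N); exact: ltW.
  rewrite mulr_sumr big_nat_cond [RHS]big_nat_cond.
  apply: eq_bigr => -[//|i] _; by rewrite /weight1/= invf_div.
rewrite (@esumID _ _ (range Posz))//; last by move=> m _; rewrite lee_fin.
rewrite !setTI; apply: lte_add_pinfty.
  rewrite esum_image; last by move=> i j _ _ [].
  apply: (@nneseries_lty _ (1 + g * M)) => [m|[|N]]; first exact: w0.
    by rewrite big_geq// addr_ge0// mulr_ge0// ltW.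
  rewrite big_nat_recl//= /weight1 eqxx invr1 lerD2l.
  by have := SV N.+1; rewrite big_add1.
rewrite (_ : ~` range Posz = range Negz); last first.
  apply/seteqP; split=> [[m|m] /= h|_ [m _ <-] [k _ //]].
    by exfalso; apply: h; exists m.
  by exists m.
rewrite esum_image; last by move=> i j _ _ [].
apply: (@nneseries_lty _ (g * M)) => [m|N]; first exact: w0.
by have := SV N.+1; rewrite big_add1.
Qed.

(** Splitting off the first entry, the sum over tuples is at most the product of a one-dimensional
    sum and a sum of lower dimension. Indexing [u] by all naturals lets the induction pass to the
    shifted family. *)
Lemma esum_tensor_lty (d : nat) (u : nat -> int -> R) :
  (forall j m, 0 <= u j m)%R ->
  (forall j, \esum_(m in [set: int]) (u j m)%:E < +oo) ->
  \esum_(h in [set: d.-tuple int]) (\prod_(j < d) u j (tnth h j))%:E < +oo.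
Proof.
elim: d u => [|d IH] u u0 uoo.
  rewrite (_ : setT = [set [tuple]]).
    by rewrite esum_set1 ?big_ord0 ?ltry// lee_fin.
  by apply/seteqP; split=> h //= _; rewrite tuple0.
pose F (p : int * d.-tuple int) : d.+1.-tuple int := [tuple of p.1 :: p.2].
pose G (t : d.-tuple int) : R := (\prod_(j < d) u j.+1 (tnth t j))%R.
have G0 t : (0 <= G t)%R by apply: prodr_ge0.
pose C := \esum_(t in [set: d.-tuple int]) (G t)%:E.
have C0 : 0 <= C by apply: esum_ge0 => t _; rewrite lee_fin.
have Coo : C < +oo by exact: (IH (fun j => u j.+1)).
rewrite (@reindex_esum _ _ _ ([set: int] `*`` (fun _ => [set: d.-tuple int])) _ F);
    last first.
  split=> //.
    by move=> [a s] [b t] _ _ [-> st]; congr pair; exact/val_inj.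
  move=> h _; exists (thead h, [tuple of behead h]) => //.
  by rewrite /F/= -tuple_eta.
rewrite (eq_esum (b := fun p => (u 0%N p.1)%:E * (G p.2)%:E)); last first.
  move=> [m t] _; rewrite -EFinM big_ord_recl; congr ((_ * _)%:E).
  by apply: eq_bigr => j _; rewrite tnthS.
rewrite -(@esum_esum _ _ _ _ _ (fun m t => (u 0%N m)%:E * (G t)%:E)); last first.
  by move=> m t _ _; rewrite -EFinM lee_fin mulr_ge0.
apply: (@le_lt_trans _ _ (C * \esum_(m in [set: int]) (u 0%N m)%:E)); last first.
  by rewrite lte_mul_pinfty// ge0_fin_numE.
apply: le_trans (esum_mulr_le _ C0 _); last by move=> m; rewrite lee_fin.
apply: le_esum => m _; rewrite [leRHS]muleC.
by apply: esum_mulr_le => [|t]; rewrite lee_fin.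
Qed.

Lemma esum_weight_lty (d : nat) (alpha : R) (gamma : nat -> R) :
  (2^-1 < alpha)%R -> (forall j, 0 < gamma j)%R ->
  \esum_(h in [set: d.-tuple int]) (weight alpha gamma h)^-1%:E < +oo.
Proof.
move=> alpha1 gamma0.
have := @esum_tensor_lty d (fun j m => (weight1 alpha (gamma j) m)^-1)%R.
under eq_esum do rewrite prodfV.
apply=> [j m|j]; last exact: esum_weight1_lty.
by rewrite invr_ge0 ltW// weight1_gt0.
Qed.

End summability.

(** * Root-mean-squared error *)

Section root_mean_square.
Context {R : realType} {d n : nat}.
Variables (z : d.-tuple 'I_n) (alpha : R) (gamma : nat -> R).
Hypotheses (n_gt0 : (0 < n)%N) (gamma_gt0 : forall j, 0 < gamma j).
Local Notation TR := (measurableTypeR R).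
Local Open Scope complex_scope.

Lemma cosine_wce_sqr (Delta : d.-tuple R) :
  (cosine_wce alpha gamma (tent_shifted_lattice_rule z Delta) ^+ 2 =
   \esum_(k in ~` [set [tuple 0%N | _ < d]])
     (tent_quadrature z k Delta ^+ 2 / weight alpha gamma (tuple_int k))%:E)%E.
Proof.
have cos0 (x : d.-tuple R) : (cosine_basis [tuple 0%N | _ < d] x)%:C = 1.
  rewrite /cosine_basis nnzE !big1 ?mulr1// => j _.
    by rewrite tnth_mktuple mulr0 mul0r cos0.
  by rewrite tnth_map tnth_mktuple.
have := @worst_case_error_sqr R d _ (fun k x => (cosine_basis k x)%:C)
  (fun k x => (cosine_basis k x)%:C) (weight alpha gamma \o @tuple_int d)
  [tuple 0%N | _ < d] (@complex_bounded_measurable_cosine R d)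
  (@complex_bounded_measurable_cosine R d) (@cosine_orthonormal R d)
  cos0 cos0 _ n (tent_node z Delta) n_gt0 (@unit_cube_tent_node R d n z Delta).
rewrite -[quadrature _ _]/(tent_shifted_lattice_rule z Delta) => ->.
  apply: eq_esum => k _.
  rewrite -[tent_shifted_lattice_rule z Delta]/(quadrature n (tent_node z Delta)).
  by rewrite quadrature_cosine cmodulus_real real_normK ?num_real.
by move=> k; exact: weight_gt0.
Qed.

Lemma rms_cosine_wce_sqr :
  (rms_cosine_wce alpha gamma z ^+ 2 =
  \esum_(k in [set k | dual_lattice z k /\ k <> [tuple 0%R | _ < d]])
    (2 ^- nnz k / weight alpha gamma k)%:E)%E.
Proof.
have w0 (h : d.-tuple int) : 0 < weight alpha gamma h by exact: weight_gt0.
have mC := @measurable_unit_cube R d.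
pose F (k : d.-tuple nat) (Delta : d.-tuple TR) : R :=
  tent_quadrature z k Delta ^+ 2 / weight alpha gamma (tuple_int k).
have F0 k Delta : (0 <= (F k Delta)%:E)%E.
  by rewrite lee_fin divr_ge0 ?sqr_ge0// ltW.
have bF k : bounded_measurable (F k).
  apply: bounded_measurableM; last exact: bounded_measurable_cst.
  under eq_fun do rewrite expr2.
  by apply: bounded_measurableM; exact: bounded_measurable_tent_quadrature.
rewrite /rms_cosine_wce sqr_sqrte; last first.
  apply: integral_ge0 => Delta _; rewrite cosine_wce_sqr.
  by apply: esum_ge0 => k _; exact: F0.
(* From here on the integrand is a countable sum of nonnegative measurable functions of the shift,
   so Tonelli applies. *)
under eq_integral do rewrite cosine_wce_sqr.
rewrite (@integral_esum _ _ _ _ _ _ _ (fun k Delta => (F k Delta)%:E))//; last first.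
  by move=> k; apply/measurable_EFinP; exact: measurable_funTS (bF k).1.
(* The dual lattice enters as an indicator, so that the regrouping by signs can run over all nonzero
   integer tuples. *)
pose a (h : d.-tuple int) : \bar R := (if h \in dual_lattice z
  then (2 ^- nnz h / weight alpha gamma h)%:E else 0)%E.
have a0 h : (0 <= a h)%E.
  by rewrite /a; case: ifP => // _; rewrite lee_fin divr_ge0 ?invr_ge0 ?exprn_ge0// ltW.
transitivity (\esum_(h in ~` [set [tuple 0%R | _ < d]]) a h)%E; last first.
  rewrite /a -esum_mkcondr; congr esum.
  by apply/seteqP; split=> h [].
rewrite -esum_signed//; apply: eq_esum => k _.
transitivity (\int[lebesgue_measure_tuple d]_(Delta in @unit_cube R d) F k Delta)%:E.
  rewrite /Rintegral fineK//; apply: integrable_fin_num => //.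
  exact: bounded_measurable_integrable (@lebesgue_measure_unit_cube_lty R d) (bF k).
rewrite RintegralZr//; last first.
  apply: bounded_measurable_integrable (@lebesgue_measure_unit_cube_lty R d) _ => //.
  under eq_fun do rewrite expr2.
  by apply: bounded_measurableM; exact: bounded_measurable_tent_quadrature.
rewrite Rintegral_tent_quadrature_sqr// mulrAC mulr_sumr -sumEFin.
(* The number of nonzero entries and the weight ignore signs, so the factor attached to [k] is the
   one attached to each signed version of it. *)
apply: eq_bigr => e _; rewrite /a nnz_signed weight_signed.
case: ifPn; rewrite ?inE ?notin_setE /dual_lattice/= => hz.
  by rewrite hz mulr1.
by rewrite (negbTE (introN idP hz)) mulr0.
Qed.

(** This makes the equalities in [\bar R] statements about real numbers. The sum is dominated by
    that of 1 / r(h) over all integer tuples. *)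
Lemma esum_dual_lattice_fin_num : 2^-1 < alpha ->
  (\esum_(k in [set k | dual_lattice z k /\ k <> [tuple 0%R | _ < d]])
    (2 ^- nnz k / weight alpha gamma k)%:E)%E \is a fin_num.
Proof.
move=> alpha1; have w0 (h : d.-tuple int) : 0 < weight alpha gamma h.
  exact: weight_gt0.
have t0 (h : d.-tuple int) : 0 <= 2 ^- nnz h / weight alpha gamma h.
  by rewrite divr_ge0 ?invr_ge0 ?exprn_ge0// ltW.
rewrite ge0_fin_numE; last by apply: esum_ge0 => k _; rewrite lee_fin.
apply: le_lt_trans (esum_weight_lty d alpha1 gamma_gt0).
rewrite esum_mkcond; apply: le_esum => h _; case: ifP => _.
  rewrite lee_fin ler_piMl ?invr_ge0 ?(ltW (w0 h))//.
  by rewrite invf_le1 ?exprn_gt0// exprn_ege1// ler1n.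
by rewrite lee_fin invr_ge0 ltW.
Qed.

End root_mean_square.

Unset Implicit Arguments.

Theorem theorem4 (R : realType) (d n : nat) (alpha : R) (gamma : nat -> R)
    (z : d.-tuple 'I_n)
    (d_gt0 : (0 < d)%N) (n_gt0 : (0 < n)%N) (alpha_gt : 2^-1 < alpha)
    (gamma_le1 : gamma 0%N <= 1)
    (gamma_nincr : forall j, gamma j.+1 <= gamma j)
    (gamma_gt0 : forall j, 0 < gamma j) :
  let S := (\esum_(k in [set k | dual_lattice z k /\ k <> [tuple 0%R | _ < d]])
              (2 ^- nnz k / weight alpha gamma k)%:E)%E in
  [/\ (rms_cosine_wce alpha gamma z ^+ 2 = S)%E,
      (S = korobov_wce alpha (fun j => (gamma j / 2)%R)
             (@lattice_rule R d n z) ^+ 2)%E &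
      S \is a fin_num].
Proof.
move=> S; split.
- exact: rms_cosine_wce_sqr.
- by apply/esym; exact: korobov_wce_sqr.
- exact: esum_dual_lattice_fin_num.
Qed.
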